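(* There is an isomorphism of $\Bbbk$-algebras $\chi:\mathcal{A}_\lambda(R^\pm_{p|q},\tau,u)\to A^\pm_{p|q}$ with $\chi(X_i)=x_i$ and $\chi(Y_i)=\partial_i$ for all $i\in\{1,\dots,n\}$ (and $\chi(u_i)=\partial_ix_i$). In particular the TGW algebra $\mathcal{A}_\lambda(R^\pm_{p|q},\tau,u)$ is consistent, i.e. the canonical map $R^\pm_{p|q}\to\mathcal{A}_\lambda(R^\pm_{p|q},\tau,u)$ is injective.
   Context: $\Bbbk$ is an algebraically closed field of characteristic $0$. TGW algebras: a TGW datum with index set $I$ is a triple $(R,\sigma,t)$ with $R$ an associative unital $\Bbbk$-algebra, $\sigma=(\sigma_i)_{i\in I}$ pairwise commuting $\Bbbk$-algebra automorphisms of $R$, and $t=(t_i)_{i\in I}$ central elements of $R$. Given also scalars $\mu=(\mu_{ij})_{i\ne j}$, $\mu_{ij}\in\Bbbk\setminus\{0\}$, the TGW construction $\mathcal{C}_\mu(R,\sigma,t)$ is the free $R$-ring on $\{X_i,Y_i\mid i\in I\}$ modulo the relations $X_ir=\sigma_i(r)X_i$, $Y_ir=\sigma_i^{-1}(r)Y_i$ ($r\in R$), $Y_iX_i=t_i$, $X_iY_i=\sigma_i(t_i)$, and $X_iY_j=\mu_{ij}Y_jX_i$ ($i\neq j$). It is $\mathbb{Z}I$-graded with $\deg X_i=\mathbf{e}_i$, $\deg Y_i=-\mathbf{e}_i$, $\deg r=0$. The TGW algebra $\mathcal{A}_\mu(R,\sigma,t)$ is the quotient of $\mathcal{C}_\mu(R,\sigma,t)$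 by the largest graded two-sided ideal having zero intersection with the degree-zero component; it inherits the grading. It is called consistent if the canonical map $\rho:R\to\mathcal{A}_\mu(R,\sigma,t)$ is injective. Clifford/Weyl superalgebra: fix $p,q\ge0$, $n=p+q$, a sign $\pm\in\{+,-\}$, and write $\mp=-\pm$. Set $p(i)=0$ for $1\le i\le p$ and $p(i)=1$ for $p<i\le n$. $A^\pm_{p|q}$ is the associative unital superalgebra generated by $x_i,\partial_i$ ($1\le i\le n$) of parity $p(i)$ with relations $[\partial_i,x_j]_\pm=\delta_{ij}$, $[x_i,x_j]_\pm=[\partial_i,\partial_j]_\pm=0$, where $[a,b]_\pm=ab\pm(-1)^{p(a)p(b)}ba$. Put $\lambda_{ij}=\mp(-1)^{p(i)p(j)}$ for $i,j\in\{1,\dots,n\}$. Let $R^\pm_{p|q}=\Bbbk[u_1,\dots,u_n]/(u_i^2-u_i\mid \lambda_{ii}=-1)$ (equivalently, for those $i$ with $(-1)^{p(i)}=\pm1$). Let $\tau_i$ be the automorphism of $R^\pm_{p|q}$ with $\tau_i(u_i)=\lambda_{ii}(u_i-1)$ and $\tau_i(u_j)=u_j$ for $j\ne i$; $\tau=(\tau_i)_{i=1}^n$, $u=(u_i)_{i=1}^n$, and $\mathcal{A}_\lambda(R^\pm_{p|q},\tau,u)$ is the TGW algebra with index set $\{1,\dots,n\}$ and $\mu_{ij}=\lambda_{ij}$. *)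

(* Defs.v *)
From Stdlib Require List.
From HB Require Import structures.
From mathcomp Require Import all_boot all_order all_algebra.
Set Implicit Arguments. Unset Strict Implicit. Unset Printing Implicit Defensive.
Import GRing.Theory.
Local Open Scope ring_scope.

Inductive term (K : Type) (G : Type) : Type :=
| tVar of G
| tC of K
| tAdd of term K G & term K G
| tMul of term K G & term K G.
Arguments tVar {K G}. Arguments tC {K G}.
Arguments tAdd {K G}. Arguments tMul {K G}.

Inductive tgwGen (n : nat) (GR : Type) :=
| gR of GR | gX of 'I_n | gY of 'I_n.
Arguments gR {n GR}. Arguments gX {n GR}. Arguments gY {n GR}.

Section Presented.
Variable K : fieldType.

Definition tScale G (c : K) (t : term K G) : term K G := tMul (tC c) t.
Definition tSub G (s t : term K G) : term K G := tAdd s (tScale (-1) t).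

Fixpoint tsubst G H (f : G -> term K H) (t : term K G) : term K H :=
  match t with
  | tVar g => f g
  | tC c => tC c
  | tAdd a b => tAdd (tsubst f a) (tsubst f b)
  | tMul a b => tMul (tsubst f a) (tsubst f b)
  end.

Definition tsum G (l : seq (term K G)) : term K G := foldr tAdd (tC 0) l.

(* [eqv Rel] : the smallest congruence on terms containing the axioms of
   associative unital K-algebras and the relations Rel.  Terms modulo
   [eqv Rel] form the K-algebra  K<G> / (ideal generated by Rel). *)
Inductive eqv G (Rel : term K G -> term K G -> Prop) : term K G -> term K G -> Prop :=
| eqv_rel a b : Rel a b -> eqv Rel a b
| eqv_refl a : eqv Rel a a
| eqv_sym a b : eqv Rel a b -> eqv Rel b a
| eqv_trans a b c : eqv Rel a b -> eqv Rel b c -> eqv Rel a c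
| eqv_add a a' b b' : eqv Rel a a' -> eqv Rel b b' -> eqv Rel (tAdd a b) (tAdd a' b')
| eqv_mul a a' b b' : eqv Rel a a' -> eqv Rel b b' -> eqv Rel (tMul a b) (tMul a' b')
| eqv_addA a b c : eqv Rel (tAdd (tAdd a b) c) (tAdd a (tAdd b c))
| eqv_addC a b : eqv Rel (tAdd a b) (tAdd b a)
| eqv_add0 a : eqv Rel (tAdd (tC 0) a) a
| eqv_addN a : eqv Rel (tAdd a (tMul (tC (-1)) a)) (tC 0)
| eqv_mulA a b c : eqv Rel (tMul (tMul a b) c) (tMul a (tMul b c))
| eqv_mul1l a : eqv Rel (tMul (tC 1) a) a
| eqv_mul1r a : eqv Rel (tMul a (tC 1)) a
| eqv_mulDl a b c : eqv Rel (tMul (tAdd a b) c) (tAdd (tMul a c) (tMul b c))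
| eqv_mulDr a b c : eqv Rel (tMul a (tAdd b c)) (tAdd (tMul a b) (tMul a c))
| eqv_Cadd x y : eqv Rel (tC (x + y)) (tAdd (tC x) (tC y))
| eqv_Cmul x y : eqv Rel (tC (x * y)) (tMul (tC x) (tC y))
| eqv_Ccomm x a : eqv Rel (tMul (tC x) a) (tMul a (tC x)).

Section TGW.
Variables (n : nat) (GR : Type) (RelR : term K GR -> term K GR -> Prop).
Variables (sigma : 'I_n -> GR -> term K GR) (t : 'I_n -> term K GR).
Variable (mu : 'I_n -> 'I_n -> K).

Local Notation CT := (term K (tgwGen n GR)).

Definition tgw_iota (r : term K GR) : CT := tsubst (fun g => tVar (gR g)) r.
Definition tgw_sig (i : 'I_n) (r : term K GR) : term K GR := tsubst (sigma i) r.
Definition Xt (i : 'I_n) : CT := tVar (gX i).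
Definition Yt (i : 'I_n) : CT := tVar (gY i).

(* Defining relations of C_mu(R, sigma, t) as the free R-ring on X_i, Y_i:
   the relations of R, and
   X_i r = sigma_i(r) X_i,  Y_i r = sigma_i^{-1}(r) Y_i  (stated in the
   equivalent form Y_i sigma_i(r) = r Y_i),  Y_i X_i = t_i,
   X_i Y_i = sigma_i(t_i),  X_i Y_j = mu_ij Y_j X_i  (i <> j). *)
Inductive tgw_rel : CT -> CT -> Prop :=
| tgwr_R r s : RelR r s -> tgw_rel (tgw_iota r) (tgw_iota s)
| tgwr_X i r : tgw_rel (tMul (Xt i) (tgw_iota r)) (tMul (tgw_iota (tgw_sig i r)) (Xt i))
| tgwr_Y i r : tgw_rel (tMul (Yt i) (tgw_iota (tgw_sig i r))) (tMul (tgw_iota r) (Yt i))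
| tgwr_YX i : tgw_rel (tMul (Yt i) (Xt i)) (tgw_iota (t i))
| tgwr_XY i : tgw_rel (tMul (Xt i) (Yt i)) (tgw_iota (tgw_sig i (t i)))
| tgwr_mu i j : i != j ->
    tgw_rel (tMul (Xt i) (Yt j)) (tScale (mu i j) (tMul (Yt j) (Xt i))).

Definition tgwC_eq : CT -> CT -> Prop := eqv tgw_rel.

Definition zdeg := {ffun 'I_n -> int}.
Definition unitvec (i : 'I_n) : zdeg := [ffun j => ((i == j) : nat)%:Z].

(* [homog d a] : the term a is syntactically homogeneous of degree d;
   the homogeneous component C_d is the set of classes of such terms. *)
Inductive homog : zdeg -> CT -> Prop :=
| homog_C c : homog 0 (tC c)
| homog_R g : homog 0 (tVar (gR g))
| homog_X i : homog (unitvec i) (Xt i)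
| homog_Y i : homog (- unitvec i) (Yt i)
| homog_add d a b : homog d a -> homog d b -> homog d (tAdd a b)
| homog_mul d e a b : homog d a -> homog e b -> homog (d + e) (tMul a b).

Definition in_deg (d : zdeg) (a : CT) : Prop :=
  exists a', tgwC_eq a a' /\ homog d a'.

Definition is_ideal (J : CT -> Prop) : Prop :=
  [/\ forall a b, tgwC_eq a b -> J a -> J b,
      J (tC 0),
      forall a b, J a -> J b -> J (tAdd a b) &
      forall a b, J b -> J (tMul a b) /\ J (tMul b a)].

Definition is_graded (J : CT -> Prop) : Prop :=
  forall a, J a -> exists l : seq (zdeg * CT),
    tgwC_eq a (tsum (map snd l)) /\
    forall x, List.In x l -> in_deg x.1 x.2 /\ J x.2.

Definition meets_deg0_trivially (J : CT -> Prop) : Prop :=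
  forall a, J a -> in_deg 0 a -> tgwC_eq a (tC 0).

(* membership in the largest graded ideal of C having zero intersection
   with C_0 (the union of all such ideals) *)
Definition tgw_maxideal (a : CT) : Prop :=
  exists J, [/\ is_ideal J, is_graded J, meets_deg0_trivially J & J a].

Definition tgwA_eq (a b : CT) : Prop := tgw_maxideal (tSub a b).

Definition R_eq : term K GR -> term K GR -> Prop := eqv RelR.

Definition tgw_consistent : Prop :=
  forall r s, tgwA_eq (tgw_iota r) (tgw_iota s) -> R_eq r s.

End TGW.

Definition is_alg_iso G H (eqA : term K G -> term K G -> Prop)
  (eqB : term K H -> term K H -> Prop) (chi : term K G -> term K H) : Prop :=
  [/\ forall a b, eqA a b -> eqB (chi a) (chi b),
      (forall a b, eqB (chi (tAdd a b)) (tAdd (chi a) (chi b))) /\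
      (forall a b, eqB (chi (tMul a b)) (tMul (chi a) (chi b))) /\
      (forall c, eqB (chi (tC c)) (tC c)),
      forall a b, eqB (chi a) (chi b) -> eqA a b &
      forall w, exists a, eqB (chi a) w].

(* sign pm : true is '+', false is '-'.  Indices are 'I_(p+q), zero-based:*)
(* index i (0 <= i < p+q) corresponds to i+1 in the paper.             *)

Section CliffordWeyl.
Variables (p q : nat) (pm : bool).
Local Notation n := (p + q)%N.

Definition sgn : K := if pm then 1 else -1.
Definition par (i : 'I_n) : bool := (p <= i)%N.
Definition eps (i j : 'I_n) : K := if par i && par j then -1 else 1.
Definition lam (i j : 'I_n) : K := - sgn * eps i j.

Inductive wGen := gx of 'I_n | gd of 'I_n.
Local Notation WT := (term K wGen).
Definition xt i : WT := tVar (gx i).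
Definition dt i : WT := tVar (gd i).
Definition sbr (a b : WT) (ea : K) : WT := tAdd (tMul a b) (tScale (sgn * ea) (tMul b a)).

Inductive weyl_rel : WT -> WT -> Prop :=
| wr_dx i j : weyl_rel (sbr (dt i) (xt j) (eps i j)) (tC ((i == j) : nat)%:R)
| wr_xx i j : weyl_rel (sbr (xt i) (xt j) (eps i j)) (tC 0)
| wr_dd i j : weyl_rel (sbr (dt i) (dt j) (eps i j)) (tC 0).

Definition weyl_eq : WT -> WT -> Prop := eqv weyl_rel.

Definition ut (i : 'I_n) : term K 'I_n := tVar i.
Inductive Rpm_rel : term K 'I_n -> term K 'I_n -> Prop :=
| Rr_comm i j : Rpm_rel (tMul (ut i) (ut j)) (tMul (ut j) (ut i))
| Rr_idem i : lam i i = -1 -> Rpm_rel (tMul (ut i) (ut i)) (ut i).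

Definition tau (i : 'I_n) (j : 'I_n) : term K 'I_n :=
  if j == i then tScale (lam i i) (tSub (ut i) (tC 1)) else ut j.

Definition Rpm_tgwA_eq := tgwA_eq Rpm_rel tau ut lam.
Definition Rpm_consistent := tgw_consistent Rpm_rel tau ut lam.

End CliffordWeyl.
End Presented.
Arguments xt {K p q} i.
Arguments dt {K p q} i.

(* Main.v *)
Require Import Defs.
From Stdlib Require List.
From HB Require Import structures.
From mathcomp Require Import all_boot all_order all_algebra.
From mathcomp Require Import boolp zify ring.
Set Implicit Arguments. Unset Strict Implicit. Unset Printing Implicit Defensive.
Import Order.TTheory GRing.Theory Num.Theory.
Local Open Scope ring_scope. Local Open Scope quotient_scope.

(** The Clifford-Weyl superalgebra acts on a Fock module with basis [v_b], where [b]
    runs over the multidegrees with [b_i <= 1] at the Clifford indices: up to signs,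
    [x_i v_b = v_(b + e_i)] and [d_i v_b = b_i v_(b - e_i)].  Applied to the weight
    vectors [v_b], the ordered monomials [x^l d^m] are triangular with respect to the
    length of [m], so the action is faithful; similarly the polynomials in the [u_i]
    are separated by the weights.  The map [chi] sending [X_i], [Y_i], [u_i] to
    [x_i], [d_i], [d_i x_i] therefore has a kernel meeting degree zero, which is the
    image of [R], trivially; it is graded because weight spaces are one-dimensional.
    Conversely a homogeneous element acting nontrivially can be multiplied by a
    monomial into a degree zero element acting nontrivially, so every graded ideal
    meeting degree zero trivially lies in this kernel. *)

(** * The algebra presented by generators and relations *)

Section Quotient.
Variables (K : fieldType) (G : Type) (Rel : term K G -> term K G -> Prop).

(** Equality and choice on terms are classical, since [G] is an arbitrary type; this lets the
    propositional [eqv Rel] be divided out, and relations become equations that can be rewritten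
    with. *)
HB.instance Definition _ := gen_eqMixin (term K G).
HB.instance Definition _ := gen_choiceMixin (term K G).

Definition eqvb : rel (term K G) := fun a b => `[< eqv Rel a b >].

Lemma eqvb_equiv : equiv_class_of eqvb.
Proof.
split=> [a|a b|b a c]; first by apply/asboolP; exact: eqv_refl.
- by apply/asboolP/asboolP => h; exact: eqv_sym.
- move=> /asboolP h1 /asboolP h2; apply/asboolP; exact: eqv_trans h2.
Qed.

Canonical eqvb_equivRel := EquivRelPack eqvb_equiv.

Definition quo := {eq_quot eqvb}%qT.
HB.instance Definition _ := Choice.on quo.

Definition cls (a : term K G) : quo := (\pi_quo a).

Lemma clsP a b : cls a = cls b <-> eqv Rel a b.
Proof.
split=> [/eqquotP/asboolP //|h]; by apply/eqquotP/asboolP.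
Qed.

Lemma cls_surj (x : quo) : exists a, x = cls a.
Proof. by exists (repr x); rewrite /cls reprK. Qed.

Definition qadd (x y : quo) : quo := cls (tAdd (repr x) (repr y)).
Definition qmul (x y : quo) : quo := cls (tMul (repr x) (repr y)).
Definition qscale (c : K) (x : quo) : quo := cls (tMul (tC c) (repr x)).

Lemma repr_cls a : eqv Rel (repr (cls a)) a.
Proof. by apply/clsP; rewrite /cls reprK. Qed.

Lemma qaddE a b : qadd (cls a) (cls b) = cls (tAdd a b).
Proof. by apply/clsP; apply: eqv_add; exact: repr_cls. Qed.

Lemma qmulE a b : qmul (cls a) (cls b) = cls (tMul a b).
Proof. by apply/clsP; apply: eqv_mul; exact: repr_cls. Qed.

Lemma qscaleE c a : qscale c (cls a) = cls (tMul (tC c) a).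
Proof. by apply/clsP; apply: eqv_mul; [exact: eqv_refl|exact: repr_cls]. Qed.

Lemma qaddA : associative qadd.
Proof.
move=> x y z; have [a ->] := cls_surj x; have [b ->] := cls_surj y.
have [c ->] := cls_surj z; rewrite !qaddE; apply/clsP/eqv_sym; exact: eqv_addA.
Qed.

Lemma qaddC : commutative qadd.
Proof.
move=> x y; have [a ->] := cls_surj x; have [b ->] := cls_surj y.
rewrite !qaddE; apply/clsP; exact: eqv_addC.
Qed.

Lemma qadd0 : left_id (cls (tC 0)) qadd.
Proof.
move=> x; have [a ->] := cls_surj x; rewrite qaddE; apply/clsP; exact: eqv_add0.
Qed.

Lemma qaddN : left_inverse (cls (tC 0)) (qscale (-1)) qadd.
Proof.
move=> x; have [a ->] := cls_surj x; rewrite qscaleE qaddC qaddE; apply/clsP.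
exact: eqv_addN.
Qed.

HB.instance Definition _ := GRing.isZmodule.Build quo qaddA qaddC qadd0 qaddN.

Lemma qmulA : associative qmul.
Proof.
move=> x y z; have [a ->] := cls_surj x; have [b ->] := cls_surj y.
have [c ->] := cls_surj z; rewrite !qmulE; apply/clsP/eqv_sym; exact: eqv_mulA.
Qed.

Lemma qmul1l : left_id (cls (tC 1)) qmul.
Proof.
move=> x; have [a ->] := cls_surj x; rewrite qmulE; apply/clsP; exact: eqv_mul1l.
Qed.

Lemma qmul1r : right_id (cls (tC 1)) qmul.
Proof.
move=> x; have [a ->] := cls_surj x; rewrite qmulE; apply/clsP; exact: eqv_mul1r.
Qed.

Lemma qmulDl : left_distributive qmul qadd.
Proof.
move=> x y z; have [a ->] := cls_surj x; have [b ->] := cls_surj y.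
have [c ->] := cls_surj z; rewrite !(qmulE, qaddE); apply/clsP; exact: eqv_mulDl.
Qed.

Lemma qmulDr : right_distributive qmul qadd.
Proof.
move=> x y z; have [a ->] := cls_surj x; have [b ->] := cls_surj y.
have [c ->] := cls_surj z; rewrite !(qmulE, qaddE); apply/clsP; exact: eqv_mulDr.
Qed.

(** The structure admits 1 = 0: an arbitrary [Rel] may collapse the quotient. *)
HB.instance Definition _ :=
  GRing.Zmodule_isPzRing.Build quo qmulA qmul1l qmul1r qmulDl qmulDr.

Lemma clsD a b : cls (tAdd a b) = cls a + cls b. Proof. exact/esym/qaddE. Qed.
Lemma clsM a b : cls (tMul a b) = cls a * cls b. Proof. exact/esym/qmulE. Qed.
Lemma cls0 : cls (tC 0) = 0. Proof. by []. Qed.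
Lemma cls1 : cls (tC 1) = 1. Proof. by []. Qed.
Lemma qscale_mul c x : qscale c x = cls (tC c) * x.
Proof. by have [a ->] := cls_surj x; rewrite qscaleE clsM. Qed.

Lemma clsC_add c d : cls (tC (c + d)) = cls (tC c) + cls (tC d).
Proof. by rewrite -clsD; apply/clsP; exact: eqv_Cadd. Qed.
Lemma clsC_mul c d : cls (tC (c * d)) = cls (tC c) * cls (tC d).
Proof. by rewrite -clsM; apply/clsP; exact: eqv_Cmul. Qed.
Lemma clsC_comm c x : cls (tC c) * x = x * cls (tC c).
Proof. by have [a ->] := cls_surj x; rewrite -!clsM; apply/clsP; exact: eqv_Ccomm. Qed.

Lemma qscaleA c d x : qscale c (qscale d x) = qscale (c * d) x.
Proof. by rewrite !qscale_mul clsC_mul mulrA. Qed.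
Lemma qscale1 : left_id 1 qscale.
Proof. by move=> x; rewrite qscale_mul cls1 mul1r. Qed.
Lemma qscaleDr : right_distributive qscale +%R.
Proof. by move=> c x y; rewrite !qscale_mul mulrDr. Qed.
Lemma qscaleDl x : {morph qscale^~ x : c d / c + d}.
Proof. by move=> c d; rewrite !qscale_mul clsC_add mulrDl. Qed.

HB.instance Definition _ :=
  GRing.Zmodule_isLmodule.Build K quo qscaleA qscale1 qscaleDr qscaleDl.

Lemma qscaleAl (c : K) (x y : quo) : c *: (x * y) = (c *: x) * y.
Proof. by rewrite /GRing.scale /= !qscale_mul mulrA. Qed.

Lemma qscaleAr (c : K) (x y : quo) : c *: (x * y) = x * (c *: y).
Proof. by rewrite /GRing.scale /= !qscale_mul !mulrA clsC_comm. Qed.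

Lemma clsC c : cls (tC c) = c *: (1 : quo).
Proof. by rewrite /GRing.scale /= qscale_mul mulr1. Qed.

Lemma clsZ c a : cls (tScale c a) = c *: cls a.
Proof. by rewrite clsM clsC -qscaleAl mul1r. Qed.

Lemma clsB a b : cls (tSub a b) = cls a - cls b.
Proof. by rewrite clsD clsZ scaleN1r. Qed.

Lemma cls_sum l : cls (tsum l) = \sum_(x <- l) cls x.
Proof. by elim: l => [|a l ih]; rewrite ?big_nil ?big_cons //= clsD ih. Qed.

Definition clsE := (clsD, clsB, clsZ, clsM, clsC, cls_sum).

End Quotient.

(** The universal property of a presentation; it yields both [chi] and the map from R. *)
Lemma eqv_tsubst (K : fieldType) G H (RelG : term K G -> term K G -> Prop)
    (RelH : term K H -> term K H -> Prop) (f : G -> term K H) :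
  (forall a b, RelG a b -> eqv RelH (tsubst f a) (tsubst f b)) ->
  forall a b, eqv RelG a b -> eqv RelH (tsubst f a) (tsubst f b).
Proof.
move=> hf a b; elim=> {a b} /=; try by move=> *; constructor.
- exact: hf.
- by move=> a b c _ ? _; exact: eqv_trans.
Qed.

(** * Spanning families and triangular pairings *)

Section Span.
Variable K : fieldType.

(** Keys may repeat in the list, so that closure under addition is mere concatenation. *)
Definition spanned (V : lmodType K) T (P : pred T) (m : T -> V) (w : V) : Prop :=
  exists2 L : seq (K * T), all (fun x => P x.2) L & w = \sum_(x <- L) x.1 *: m x.2.

Section Closure.
Variables (V : lmodType K) (T : Type) (P : pred T) (m : T -> V).

Lemma spanned0 : spanned P m 0.
Proof. by exists [::]; rewrite ?big_nil. Qed.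

Lemma spanned_mono k : P k -> spanned P m (m k).
Proof. by move=> Pk; exists [:: (1, k)]; rewrite /= ?Pk // big_seq1 scale1r. Qed.

Lemma spannedD v w : spanned P m v -> spanned P m w -> spanned P m (v + w).
Proof.
move=> [L PL ->] [L' PL' ->]; exists (L ++ L'); first by rewrite all_cat PL.
by rewrite big_cat.
Qed.

Lemma spannedZ c w : spanned P m w -> spanned P m (c *: w).
Proof.
move=> [L PL ->]; exists [seq (c * x.1, x.2) | x <- L]; first by rewrite all_map.
by rewrite big_map scaler_sumr; apply: eq_bigr => x _; rewrite scalerA.
Qed.

End Closure.

Lemma spanned_map (V V' : lmodType K) T T' (P : pred T) (P' : pred T')
    (m : T -> V) (m' : T' -> V') (f : V -> V') :
  {morph f : v w / v + w} -> (forall c, {morph f : v / c *: v}) ->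
  (forall k, P k -> spanned P' m' (f (m k))) ->
  forall w, spanned P m w -> spanned P' m' (f w).
Proof.
move=> fD fZ fm w [L PL ->]; elim: L PL => [_|[c k] L ih /= /andP[Pk PL]].
  by rewrite big_nil -(scale0r (0 : V)) fZ scale0r; exact: spanned0.
rewrite big_cons fD fZ; apply: spannedD; last exact: ih.
by apply: spannedZ; exact: fm.
Qed.

Lemma sum_pred1_seq (V : nmodType) (T : eqType) (r : seq T) i (F : T -> V) :
  uniq r -> i \in r -> \sum_(j <- r | j == i) F j = F i.
Proof. by move=> ur ir; rewrite -big_filter filter_pred1_uniq // big_seq1. Qed.

Lemma sum_by_key (V : nmodType) (X : Type) (T : eqType) (key : X -> T)
    (F : X -> V) (L : seq X) :
  \sum_(x <- L) F x =
  \sum_(k <- undup (map key L)) \sum_(x <- L | key x == k) F x.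
Proof.
rewrite (exchange_big_dep predT) //=.
have: all (fun x => key x \in undup (map key L)) L.
  rewrite -(all_map key (mem (undup (map key L)))).
  by apply/allP => k kL; rewrite /= mem_undup.
move: (undup_uniq (map key L)); set U := undup _ => uU.
elim: L {U}(U) uU => [|x L ih] U uU; first by rewrite !big_nil.
move=> /= /andP[xU LU]; rewrite !big_cons (ih U) //; congr (_ + _).
by under eq_bigl do rewrite eq_sym; rewrite sum_pred1_seq.
Qed.

(** Induction on the height of [k]. In the sum tested at [k], keys of smaller height have total
    coefficient 0 by induction, and other keys of height at least [h k] pair to 0; what remains is
    the coefficient of [k] times the nonzero [e k k]. *)
Lemma triangular_coef0 (T : eqType) (P : pred T) (h : T -> nat)
    (e : T -> T -> K) (L : seq (K * T)) :
  all (fun x => P x.2) L ->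
  (forall k, P k -> e k k != 0) ->
  (forall k k', P k -> P k' -> (h k <= h k')%N -> k != k' -> e k' k = 0) ->
  (forall k, P k -> \sum_(x <- L) x.1 * e x.2 k = 0) ->
  forall k, P k -> \sum_(x <- L | x.2 == k) x.1 = 0.
Proof.
move=> PL ek0 e0 sum0 k; move: {2}(h k).+1 (ltnSn (h k)) => N.
elim: N k => // N ih k; rewrite ltnS => hk Pk.
have := sum0 _ Pk; rewrite (sum_by_key (fun x => x.2)).
have PU k' : k' \in undup (map snd L) -> P k'.
  by rewrite mem_undup => /mapP[x xL ->]; exact: (allP PL).
under eq_bigr => k' _.
  under eq_bigr => x /eqP -> do over.
  rewrite -mulr_suml; over.
rewrite big_seq; under eq_bigr => k' /PU Pk'.
  rewrite (_ : _ * _ = if k' == k then (\sum_(x <- L | x.2 == k) x.1) * e k k else 0).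
    over.
  case: eqP => [-> //|/eqP nk]; case: (leqP (h k) (h k')) => hkk.
    by rewrite e0 ?mulr0 // eq_sym.
  by rewrite ih ?mul0r // (leq_trans hkk).
rewrite -big_mkcondr -big_seq_cond /=.
have [kU|kU] := boolP (k \in undup (map snd L)).
  rewrite sum_pred1_seq ?undup_uniq // => /eqP; rewrite mulf_eq0 (negPf (ek0 _ Pk)).
  by rewrite orbF => /eqP.
move=> _; rewrite big_seq_cond big_pred0 // => x; apply/negbTE/negP => /andP[xL /eqP xk].
by case/negP: kU; rewrite mem_undup; apply/mapP; exists x.
Qed.

Lemma triangular_sum0 (V : lmodType K) (T : eqType) (P : pred T) (m : T -> V)
    (h : T -> nat) (e : T -> T -> K) (L : seq (K * T)) :
  all (fun x => P x.2) L ->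
  (forall k, P k -> e k k != 0) ->
  (forall k k', P k -> P k' -> (h k <= h k')%N -> k != k' -> e k' k = 0) ->
  (forall k, P k -> \sum_(x <- L) x.1 * e x.2 k = 0) ->
  \sum_(x <- L) x.1 *: m x.2 = 0.
Proof.
move=> PL ek0 e0 sum0; rewrite (sum_by_key snd) big_seq big1 // => k.
rewrite mem_undup => /mapP[x xL ->]; under eq_bigr => y /eqP -> do over.
rewrite -scaler_suml (triangular_coef0 (P := P) (h := h) (e := e)) ?scale0r //.
exact: (allP PL).
Qed.

End Span.

(** * The Fock representation *)

Section Representation.
Variables (K : fieldType) (charK0 : [pchar K] =i pred0).
Variables (p q : nat) (pm : bool).
Local Notation n := (p + q)%N.
Local Notation I := 'I_n.
Local Notation deg := (zdeg n).
Local Notation la := (lam K pm).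
Local Notation e := (@unitvec n).
Local Notation state := (deg -> K).

Lemma natK_eq0 k : (k%:R == 0 :> K) = (k == 0%N).
Proof. by move/pcharf0P: charK0. Qed.

Lemma eq_natK k l : (k%:R == l%:R :> K) = (k == l).
Proof.
wlog kl : k l / (k <= l)%N.
  by move=> h; case: (leqP k l) => [/h //|/ltnW/h]; rewrite eq_sym => ->; rewrite eq_sym.
by rewrite -(subnKC kl) natrD -{1}[k%:R]addr0 (inj_eq (addrI _)) eq_sym natK_eq0
  -{2}[k]addn0 eqn_add2l eq_sym.
Qed.

Lemma lamC (i j : I) : la i j = la j i.
Proof. by rewrite /lam /eps andbC. Qed.

Lemma lam_pm1 (i j : I) : la i j = 1 \/ la i j = -1.
Proof.
rewrite /lam /eps /sgn.
by case: pm; case: ifP => _; rewrite ?mulr1 ?mulrN1 ?opprK; auto.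
Qed.

Lemma lam_sqr (i j : I) : la i j * la i j = 1.
Proof. by case: (lam_pm1 i j) => ->; rewrite ?mulr1 // mulrNN mulr1. Qed.

Lemma lam_neq0 (i j : I) : la i j != 0.
Proof.
by apply/eqP => h; move/eqP: (lam_sqr i j); rewrite h mul0r eq_sym oner_eq0.
Qed.

Lemma unitvecE (i j : I) : e i j = ((i == j) : nat)%:Z.
Proof. by rewrite ffunE. Qed.

Lemma coordD (b : deg) (i k : I) : (b + e i) k = b k + (if i == k then 1 else 0) :> int.
Proof. by rewrite !ffunE; case: eqP. Qed.

Lemma coordB (b : deg) (i k : I) : (b - e i) k = b k - (if i == k then 1 else 0) :> int.
Proof. by rewrite !ffunE; case: eqP. Qed.

Definition coordE := (coordB, coordD).

(** The Clifford indices are those with [la i i = -1]. *)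
Definition fock (b : deg) : bool :=
  [forall i : I, (0 <= b i) && ((la i i == -1) ==> (b i <= 1))].

Lemma fockP (b : deg) :
  reflect (forall i : I, 0 <= b i /\ (la i i = -1 -> b i <= 1)) (fock b).
Proof.
apply: (iffP forallP) => h i; have := h i.
  by case/andP=> -> /implyP h1; split=> // h2; apply: h1; apply/eqP.
by case=> -> h1; apply/implyP => /eqP.
Qed.

(** Fock weights form a box. This places the intermediate weights of a composite of operators. *)
Lemma fock_between (a b c : deg) :
  fock a -> fock c -> (forall i : I, a i <= b i) -> (forall i : I, b i <= c i) -> fock b.
Proof.
move=> /fockP fa /fockP fc ab bc; apply/fockP => i; split.
  by case: (fa i) => h _; exact: le_trans (ab i).
by move=> li; case: (fc i) => _ /(_ li) h; exact: le_trans (bc i) h.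
Qed.

(* The Jordan-Wigner sign: it makes the operators of different indices commute up
   to [la i j]. *)
Definition jwsign (i : I) (b : deg) : K := \prod_(j < n | (j < i)%N) la i j ^ b j.

Lemma jwsignD i b c : jwsign i (b + c) = jwsign i b * jwsign i c.
Proof.
rewrite /jwsign -big_split /=; apply: eq_bigr => j _.
by rewrite ffunE expfzDr ?lam_neq0.
Qed.

Lemma jwsign_e i j : jwsign i (e j) = if (j < i)%N then la i j else 1.
Proof.
rewrite /jwsign; case: ifP => ji.
  rewrite (bigD1 j) //= unitvecE eqxx expr1z big1 ?mulr1 // => k /andP[_ kj].
  by rewrite unitvecE eq_sym (negPf kj) expr0z.
rewrite big1 // => k ki; rewrite unitvecE; case: eqP => [jk|_]; last by rewrite expr0z.
by rewrite jk ki in ji.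
Qed.

Lemma jwsign_sqr i b : jwsign i b * jwsign i b = 1.
Proof.
rewrite /jwsign -big_split /= big1 // => j _; rewrite -expfzMl lam_sqr.
by rewrite exp1rz.
Qed.

Lemma jwsign_neq0 i b : jwsign i b != 0.
Proof.
apply/eqP => h; move/eqP: (jwsign_sqr i b).
by rewrite h mul0r eq_sym oner_eq0.
Qed.

Lemma jwsignB i b j : jwsign i (b - e j) = jwsign i b * jwsign i (e j).
Proof.
rewrite -{2}(subrK (e j) b) [in RHS]jwsignD -mulrA.
by rewrite jwsign_sqr mulr1.
Qed.

Lemma jwsign_self i : jwsign i (e i) = 1.
Proof. by rewrite jwsign_e ltnn. Qed.

(** Of the two signs, one is [la i j] and the other is 1, according to the order of [i] and [j]. *)
Lemma jwsign_swap i j : i != j -> jwsign j (e i) = la i j * jwsign i (e j).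
Proof.
move=> ij; rewrite !jwsign_e lamC; case: ltngtP => [||/val_inj/eqP].
- by rewrite mulr1.
- by rewrite lamC lam_sqr.
- by rewrite (negPf ij).
Qed.

(* States are formal infinite sums of weight vectors, given by their coefficients. *)
Definition opx (i : I) (f : state) : state := fun b =>
  if fock b then jwsign i b * f (b - e i) else 0.
(** Coefficients are read at the target weight, so [b i + 1] is the exponent at the source weight
    [b + e i]. *)
Definition opd (i : I) (f : state) : state := fun b =>
  if fock b then jwsign i b * (b i + 1)%:~R * f (b + e i) else 0.

Definition supported (f : state) : Prop := forall b, ~~ fock b -> f b = 0.

Lemma opx_supp i f : supported (opx i f).
Proof. by move=> b /negPf nb; rewrite /opx nb. Qed.

Lemma opd_supp i f : supported (opd i f).
Proof. by move=> b /negPf nb; rewrite /opd nb. Qed.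

Lemma supp_fock f b : supported f -> f b != 0 -> fock b.
Proof. by move=> sf; apply: contraNT => /sf ->. Qed.

(** If [f] does not vanish at the source weight, both intermediate weights lie between two Fock
    weights, so nothing is truncated and only the signs differ. A repeated Clifford index would
    leave the box, and both sides are 0. *)
Lemma opxC i j f b : supported f ->
  opx i (opx j f) b = la i j * opx j (opx i f) b.
Proof.
move=> sf; rewrite /opx; case: ifP => fb; last by rewrite mulr0.
rewrite (addrAC b (- e j)).
have [f0|f0] := eqVneq (f (b - e i - e j)) 0.
  by rewrite f0 !(mulr0, if_same).
have fij := supp_fock sf f0.
have [eij|nij] := eqVneq i j.
  subst j; case: (lam_pm1 i i) => li; first by rewrite li mul1r.
  case: (fockP _ fb i) => _ /(_ li); case: (fockP _ fij i) => + _.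
  by rewrite !coordE eqxx => *; exfalso; lia.
rewrite !(fock_between fij fb).
- by rewrite !jwsignB (jwsign_swap nij); ring.
all: by move=> k; rewrite !coordE; do ?[case: eqP => _]; lia.
Qed.

Lemma opdC i j f b : supported f ->
  opd i (opd j f) b = la i j * opd j (opd i f) b.
Proof.
move=> sf; rewrite /opd; case: ifP => fb; last by rewrite mulr0.
rewrite (addrAC b (e j)).
have [f0|f0] := eqVneq (f (b + e i + e j)) 0.
  by rewrite f0 !(mulr0, if_same).
have fij := supp_fock sf f0.
have [eij|nij] := eqVneq i j.
  subst j; case: (lam_pm1 i i) => li; first by rewrite li mul1r.
  case: (fockP _ fb i) => + _; case: (fockP _ fij i) => _ /(_ li).
  by rewrite !coordE eqxx => *; exfalso; lia.
rewrite !(fock_between fb fij).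
- rewrite !jwsignD (jwsign_swap nij) !coordE (negPf nij) eq_sym (negPf nij) !addr0.
  by ring.
all: by move=> k; rewrite !coordE; do ?[case: eqP => _]; lia.
Qed.

Lemma opdxC i j f b : i != j -> supported f ->
  opd i (opx j f) b = la i j * opx j (opd i f) b.
Proof.
move=> nij sf; rewrite /opx /opd; case: ifP => fb; last by rewrite mulr0.
rewrite (addrAC b (- e j)).
have [f0|f0] := eqVneq (f (b + e i - e j)) 0.
  by rewrite f0 !(mulr0, if_same).
have /fockP fij := supp_fock sf f0; move/fockP: (fb) => fb'.
(* The two intermediate weights need not lie between source and target, but each of their
   coordinates is a coordinate of one of these. *)
have -> : fock (b + e i).
  apply/fockP => k; have := fij k; have := fb' k; rewrite !coordE.
  case: (eqVneq i k) => [ik|_]; last by rewrite !addr0.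
  by rewrite -ik eq_sym (negPf nij) subr0.
have -> : fock (b - e j).
  apply/fockP => k; have := fij k; have := fb' k; rewrite !coordE.
  case: (eqVneq j k) => [jk|_]; last by rewrite !subr0.
  by rewrite -jk (negPf nij) addr0.
rewrite jwsignD jwsignB (jwsign_swap nij) !coordE eq_sym (negPf nij) subr0.
by ring.
Qed.

(* The eigenvalue of [d_i x_i] on the weight [b]: [b_i + 1] at a Weyl index, [1 - b_i]
   at a Clifford index. *)
Definition uval (i : I) (b : deg) : K := 1 + la i i * (b i)%:~R.

Lemma fock_boundary b i : fock b -> ~~ fock (b + e i) -> la i i = -1 /\ b i = 1.
Proof.
move=> /fockP fb nf.
have [/andP[/eqP -> /eqP ->] //|h] := boolP ((la i i == -1) && (b i == 1)).
case/negP: nf; apply/fockP => k; rewrite coordD.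
have [b0 b1] := fb k; case: eqP => [ik|_]; last by rewrite addr0.
subst k; split=> [|li]; first lia.
by have := b1 li; move: h; rewrite li eqxx /=; lia.
Qed.

(** At a Clifford index the factor [b i + 1] agrees with [1 - b i] when [b i = 0]; when [b i = 1]
    raising leaves the box, and the eigenvalue [1 - b i] is 0 as well. *)
Lemma opdx i f b : supported f -> opd i (opx i f) b = uval i b * f b.
Proof.
move=> sf; rewrite /opd /opx addrK; case: ifP => fb; last by rewrite sf ?fb ?mulr0.
case: ifP => fbi.
  rewrite jwsignD jwsign_self mulr1 mulrACA jwsign_sqr mul1r; congr (_ * _).
  rewrite /uval intrD; case: (lam_pm1 i i) => li; rewrite li; first by ring.
  case: (fockP _ fb i) => b0 _; case: (fockP _ fbi i) => _ /(_ li).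
  rewrite coordD eqxx => b1; have -> : b i = 0 by lia.
  by rewrite mulr0 add0r addr0.
case: (fock_boundary fb (negbT fbi)) => li bi.
by rewrite /uval li bi mulN1r subrr mul0r mulr0.
Qed.

(** Lowering leaves the box only when [b i = 0], where the eigenvalue vanishes too. *)
Lemma opxd i f b : supported f -> opx i (opd i f) b = (b i)%:~R * f b.
Proof.
move=> sf; rewrite /opd /opx subrK; case: ifP => fb; last by rewrite sf ?fb ?mulr0.
have [fbi|nfbi] := boolP (fock (b - e i)).
  rewrite jwsignB jwsign_self mulr1 coordB eqxx subrK.
  by rewrite !mulrA jwsign_sqr mul1r.
suff -> : b i = 0 by rewrite mul0r mulr0.
apply/eqP; apply: contraR nfbi => bi; apply/fockP => k.
case: (fockP _ fb k) => b0 b1; rewrite coordB; case: eqP => [ik|_].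
  by subst k; split=> [|/b1]; lia.
by rewrite subr0.
Qed.

(** * The action of terms on states *)

Fixpoint act (t : term K (wGen p q)) (f : state) : state :=
  match t with
  | tVar (gx i) => opx i f
  | tVar (gd i) => opd i f
  | tC c => fun b => c * f b
  | tAdd s t => fun b => act s f b + act t f b
  | tMul s t => act s (act t f)
  end.

Lemma act_supp t f : supported f -> supported (act t f).
Proof.
elim: t f => [[i|i]|c|s ihs t iht|s ihs t iht] f sf /=.
- exact: opx_supp.
- exact: opd_supp.
- by move=> b nb; rewrite sf ?mulr0.
- by move=> b nb; rewrite ihs ?iht ?addr0.
- by apply: ihs; apply: iht.
Qed.

Lemma act_linear t c f g :
  act t (fun b => c * f b + g b) = fun b => c * act t f b + act t g b.
Proof.
elim: t f g => [[i|i]|d|s ihs t iht|s ihs t iht] f g /=.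
- by apply/funext => b; rewrite /opx; case: ifP => _; ring.
- by apply/funext => b; rewrite /opd; case: ifP => _; ring.
- by apply/funext => b; ring.
- by apply/funext => b; rewrite ihs iht; ring.
- by rewrite iht ihs.
Qed.

Lemma act0 t : act t (fun=> 0) = fun=> 0.
Proof.
have := act_linear t (-1) (fun=> 0) (fun=> 0).
rewrite (_ : (fun b => -1 * 0 + 0) = (fun=> 0)) => [->|]; apply/funext => b; ring.
Qed.

Lemma actZ t c f : act t (fun b => c * f b) = fun b => c * act t f b.
Proof.
have := act_linear t c f (fun=> 0); rewrite act0.
rewrite (_ : (fun b => c * f b + 0) = (fun b => c * f b)) => [->|].
  by apply/funext => b; rewrite addr0.
by apply/funext => b; rewrite addr0.
Qed.

Lemma actD t f g : act t (fun b => f b + g b) = fun b => act t f b + act t g b.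
Proof.
have := act_linear t 1 f g.
rewrite (_ : (fun b => 1 * f b + g b) = (fun b => f b + g b)) => [->|].
  by apply/funext => b; rewrite mul1r.
by apply/funext => b; rewrite mul1r.
Qed.

(** The defining relations are checked on supported states, and the product case goes through
    because [act] preserves support. *)
Lemma act_sound s t : eqv (weyl_rel pm) s t ->
  forall f, supported f -> act s f = act t f.
Proof.
have sgn_eps i j : @sgn K pm * eps K i j = - la i j by rewrite /lam mulNr opprK.
elim=> {s t} /=.
- move=> s t [i j|i j|i j] f sf; apply/funext => b; rewrite /= sgn_eps.
  + have [<-|nij] := eqVneq i j; last by rewrite opdxC // mulr0n; ring.
    by rewrite opdx // opxd // /uval mulr1n; ring.
  + by rewrite opxC // mul0r; ring.
  + by rewrite opdC // mul0r; ring.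
- by [].
- by move=> s t _ ih f sf; rewrite ih.
- by move=> s t u _ ih1 _ ih2 f sf; rewrite ih1 ?ih2.
- by move=> s s' t t' _ ih1 _ ih2 f sf; rewrite ih1 ?ih2.
- by move=> s s' t t' _ ih1 _ ih2 f sf; rewrite ih2 ?ih1 //; exact: act_supp.
- by move=> s t u f _; apply/funext => b; rewrite addrA.
- by move=> s t f _; apply/funext => b; rewrite addrC.
- by move=> s f _; apply/funext => b; rewrite mul0r add0r.
- by move=> s f _; apply/funext => b; rewrite mul0r mulN1r subrr.
- by [].
- by move=> s f _; apply/funext => b; rewrite mul1r.
- by move=> s f _; rewrite actZ; apply/funext => b; rewrite mul1r.
- by [].
- by move=> s t u f _; rewrite actD.
- by move=> c d f _; apply/funext => b; rewrite mulrDl.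
- by move=> c d f _; apply/funext => b; rewrite mulrA.
- by move=> c s f _; rewrite actZ.
Qed.

(** * Ordered monomials and faithfulness *)

Definition cnt (l : seq I) : deg := [ffun i => (count_mem i l)%:Z].

Lemma cntE l i : cnt l i = (count_mem i l)%:Z.
Proof. by rewrite ffunE. Qed.

Lemma cnt_nil : cnt [::] = 0.
Proof. by apply/ffunP => i; rewrite !ffunE. Qed.

Lemma cnt_cons i l : cnt (i :: l) = e i + cnt l.
Proof. by apply/ffunP => j; rewrite !ffunE /= PoszD. Qed.

Lemma cnt_eq_perm l l' : cnt l = cnt l' -> perm_eq l l'.
Proof.
move=> h; apply/allP => i _ /=; have := congr1 (fun f : deg => f i) h.
by rewrite !cntE => -[->].
Qed.

Lemma perm_cnt l l' : perm_eq l l' -> cnt l = cnt l'.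
Proof. by move=> /permP h; apply/ffunP => i; rewrite !cntE h. Qed.

(** A permutation of [l] is a subsequence of [l'], and a subsequence at least as long as the whole
    word is the whole word. *)
Lemma cnt_le_perm (l l' : seq I) : (forall i, (count_mem i l <= count_mem i l')%N) ->
  (size l' <= size l)%N -> perm_eq l l'.
Proof.
move=> /count_subseqP[s ss ps] sz; have := size_subseq_leqif ss.
rewrite -(perm_size ps) => h; have : size l == size l' by rewrite eqn_leq sz h.1.
by rewrite h.2 => /eqP <-.
Qed.

Definition sorted_word (l : seq I) := sorted (fun i j : I => (i <= j)%N) l.

Lemma sorted_word_eq l l' : sorted_word l -> sorted_word l' -> perm_eq l l' -> l = l'.
Proof.
apply: sorted_eq; first by move=> ? ? ?; exact: leq_trans.
by move=> i j; rewrite -eqn_leq => /eqP /val_inj.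
Qed.

(** Here [fock (cnt l)] says that no Clifford index repeats in [l]. *)
Definition normal_word l := sorted_word l && fock (cnt l).

Lemma fock0 : fock 0.
Proof. by apply/fockP => i; rewrite !ffunE. Qed.

Lemma cnt_ge0 l i : (0 : int) <= cnt l i.
Proof. by rewrite cntE. Qed.

Lemma not_fock_cnt l : ~~ fock (cnt l) ->
  exists2 i, la i i = -1 & (1 < count_mem i l)%N.
Proof.
rewrite negb_forall => /existsP[i]; rewrite cnt_ge0 negb_imply.
by case/andP=> /eqP li; rewrite cntE -ltNge; exists i.
Qed.

Lemma fock_cnt_behead i l : fock (cnt (i :: l)) -> fock (cnt l).
Proof.
move=> h; apply: (fock_between fock0 h) => j; first by rewrite [X in X <= _]ffunE cnt_ge0.
by rewrite cnt_cons addrC coordD; case: eqP => _; lia.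
Qed.

Definition xword (l : seq I) : term K (wGen p q) :=
  foldr (fun i t => tMul (xt i) t) (tC 1) l.
Definition dword (l : seq I) : term K (wGen p q) :=
  foldr (fun i t => tMul (dt i) t) (tC 1) l.
Definition wmono (k : seq I * seq I) := tMul (xword k.1) (dword k.2).

Definition delta (a : deg) : state := fun b => (b == a)%:R.

Lemma delta_supp a : fock a -> supported (delta a).
Proof. by move=> fa b; rewrite /delta; case: eqP => [->|//]; rewrite fa. Qed.

Lemma opx_delta i a : fock (a + e i) ->
  opx i (delta a) = fun b => jwsign i (a + e i) * delta (a + e i) b.
Proof.
move=> fa; apply/funext => b; rewrite /opx /delta subr_eq.
by case: eqP => [->|_]; rewrite ?fa // !mulr0 if_same.
Qed.

Lemma opd_delta i a : fock a ->
  opd i (delta (a + e i)) = fun b => jwsign i a * (a i + 1)%:~R * delta a b.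
Proof.
move=> fa; apply/funext => b; rewrite /opd /delta (inj_eq (addIr _)).
by case: eqP => [->|_]; rewrite ?fa // !mulr0 if_same.
Qed.

Lemma act_xword l : fock (cnt l) ->
  exists2 c, c != 0 & act (xword l) (delta 0) = fun b => c * delta (cnt l) b.
Proof.
elim: l => [_|i l ih fl] /=.
  by exists 1; rewrite ?oner_eq0 // cnt_nil.
have [c c0 ->] := ih (fock_cnt_behead fl).
have fl' : fock (cnt l + e i) by rewrite addrC -cnt_cons.
exists (c * jwsign i (cnt l + e i)); first by rewrite mulf_neq0 ?jwsign_neq0.
have := actZ (xt i) c (delta (cnt l)); rewrite /= => ->.
by apply/funext => b; rewrite opx_delta // cnt_cons addrC mulrA.
Qed.

Lemma act_dword l a : fock a -> fock (a + cnt l) ->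
  exists2 c, c != 0 & act (dword l) (delta (a + cnt l)) = fun b => c * delta a b.
Proof.
elim: l a => [|i l ih] a fa fl /=.
  by exists 1; rewrite ?oner_eq0 // cnt_nil addr0.
have fai : fock (a + e i).
  apply: (fock_between fa fl) => j; rewrite coordD; first by case: eqP; lia.
  rewrite cnt_cons addrA [X in _ <= X]ffunE coordD lerDl; exact: cnt_ge0.
move: fl; rewrite cnt_cons addrA => fl; have [c c0 ->] := ih _ fai fl.
exists (c * (jwsign i a * (a i + 1)%:~R)).
  (* Characteristic 0 enters here: lowering multiplies by the positive integer [a i + 1]. *)
  rewrite !mulf_neq0 ?jwsign_neq0 //; case: (fockP _ fa i) => + _.
  by case: (a i) => // m _; rewrite -PoszD -pmulrn natK_eq0 addn1.
have := actZ (dt i) c (delta (a + e i)); rewrite /= => ->.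
by apply/funext => b; rewrite opd_delta // mulrA.
Qed.

Lemma act_dword_neq0 l a b : act (dword l) (delta a) b != 0 -> b + cnt l = a.
Proof.
elim: l b => [|i l ih] b /=.
  by rewrite mul1r /delta cnt_nil addr0 natK_eq0 eqb0 negbK => /eqP.
rewrite /opd; case: ifP => _; last by rewrite eqxx.
rewrite mulf_eq0 negb_or => /andP[_ /ih]; by rewrite cnt_cons addrA.
Qed.

(** The coefficient at weight [cnt k.1] of the monomial [k'] applied to the vector of weight
    [cnt k.2]. For [k' = k] the derivations lower this vector to the vacuum and the [x] part raises
    it again. *)
Definition pairing (k' k : seq I * seq I) : K :=
  act (wmono k') (delta (cnt k.2)) (cnt k.1).

Definition normal_key (k : seq I * seq I) := normal_word k.1 && normal_word k.2.

Lemma pairing_diag k : normal_key k -> pairing k k != 0.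
Proof.
case/andP=> /andP[_ f1] /andP[_ f2]; rewrite /pairing /=.
have := act_dword (l := k.2) fock0; rewrite add0r => /(_ f2)[c c0 ->].
rewrite actZ; have [c' c'0 ->] := act_xword f1.
by rewrite /delta eqxx mulr1 mulf_neq0.
Qed.

(** A word [m'] of derivations acts nontrivially on weight [cnt m] only if its letters are among
    those of [m]; being no shorter, it equals [m]. The vacuum is then raised to weight [cnt l'],
    which is tested against [cnt l]. *)
Lemma pairing_triangular k k' : normal_key k -> normal_key k' ->
  (size k.2 <= size k'.2)%N -> k != k' -> pairing k' k = 0.
Proof.
case: k k' => [l m] [l' m'] /andP[/= /andP[sl fl] /andP[sm fm]].
move=> /andP[/= /andP[sl' fl'] /andP[sm' fm']] smm nk.
apply/eqP; apply: contraTT nk => nz.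
case: (pselect (exists b, act (dword m') (delta (cnt m)) b != 0)) => [[b nb]|h];
  last first.
  case/eqP: nz; rewrite /pairing /= (_ : act _ (delta _) = fun=> 0) ?act0 //.
  by apply/funext => b; apply/eqP; apply: contraPT h => nb; apply; exists b.
have fb := supp_fock (act_supp (dword m') (delta_supp fm)) nb.
have em : m' = m.
  apply: sorted_word_eq => //; apply: cnt_le_perm => // i.
  have : b i + (count_mem i m')%:Z = (count_mem i m)%:Z :> int.
    by rewrite -!cntE -(act_dword_neq0 nb) [RHS]ffunE.
  have [b0 _] := fockP _ fb i; clear -b0; lia.
subst m'; suff -> : l = l' by rewrite eqxx.
apply: sorted_word_eq => //; apply: cnt_eq_perm; apply/eqP; apply: contraNT nz.
rewrite /pairing /=; have := act_dword (l := m) fock0; rewrite add0r => /(_ fm)[c _ ->].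
rewrite actZ; have [c' _ ->] := act_xword fl'.
by rewrite /delta => /negPf ->; rewrite !mulr0.
Qed.

(** * Reordering products of elements that commute up to [la i j] *)

Section LamCommuting.
Variables (G : Type) (Rel : term K G -> term K G -> Prop) (y : I -> quo Rel).
Hypothesis yC : forall i j, y i * y j = la i j *: (y j * y i).

Lemma prod_rem i l : i \in l -> exists c : K,
  \prod_(k <- l) y k = c *: (y i * \prod_(k <- rem i l) y k).
Proof.
elim: l => // j l ih; rewrite inE /= big_cons; have [-> _|nij] := eqVneq j i.
  by exists 1; rewrite scale1r.
move=> /= /ih[c ->].
exists (c * la j i); rewrite big_cons -qscaleAr mulrA yC -qscaleAl scalerA.
by rewrite mulrA.
Qed.

Lemma prod_perm l l' : perm_eq l l' -> exists c : K,
  \prod_(k <- l) y k = c *: \prod_(k <- l') y k.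
Proof.
elim: l' l => [|i l' ih] l ll'.
  by rewrite (perm_nilP ll') big_nil; exists 1; rewrite scale1r.
have il : i \in l by rewrite (perm_mem ll') mem_head.
have [c ->] := prod_rem il.
have /ih[d ->] : perm_eq (rem i l) l'.
  by rewrite -(perm_cons i) -(permPl (perm_to_rem il)).
by exists (c * d); rewrite -qscaleAr scalerA big_cons.
Qed.

(** The square equals its own negative, and 2 is invertible. *)
Lemma sqr_eq0 i : la i i = -1 -> y i * y i = 0.
Proof.
move=> li; have := yC i i; rewrite li scaleN1r => /eqP; rewrite -addr_eq0 -mulr2n.
rewrite -scaler_nat => /eqP h.
by rewrite -(scale1r (y i * y i)) -(@mulVf K 2) ?natK_eq0 // -scalerA h scaler0.
Qed.

Lemma prod_normal l : exists c l', normal_word l' /\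
  \prod_(k <- l) y k = c *: \prod_(k <- l') y k.
Proof.
have [fl|nfl] := boolP (fock (cnt l)).
  pose l' := sort (fun i j : I => (i <= j)%N) l.
  have ll' : perm_eq l l' by rewrite perm_sym perm_sort.
  have [c ->] := prod_perm ll'; exists c, l'; split=> //.
  rewrite /normal_word -(perm_cnt ll') fl andbT.
  by apply: sort_sorted => i j; exact: leq_total.
(* Two copies of a Clifford letter can be pulled to the front, where their product is 0; hence the
   coefficient 0. *)
exists 0, [::]; rewrite /normal_word /= cnt_nil fock0 scale0r; split=> //.
have [i li ci] := not_fock_cnt nfl.
have il : i \in l by rewrite -has_pred1 has_count ltnW.
have [c ->] := prod_rem il.
have il' : i \in rem i l.
  by rewrite -has_pred1 has_count; move: ci; rewrite (permP (perm_to_rem il)) /= eqxx.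
by have [d ->] := prod_rem il'; rewrite -qscaleAr mulrA sqr_eq0 // mul0r !scaler0.
Qed.

End LamCommuting.

(** * Normally ordered monomials span the Clifford/Weyl superalgebra *)

Local Notation weyl := (quo (@weyl_rel K p q pm)).
Local Notation cl := (@cls K (wGen p q) (weyl_rel pm)).

Lemma sgn_epsE (i j : I) : @sgn K pm * eps K i j = - la i j.
Proof. by rewrite /lam mulNr opprK. Qed.

Lemma weyl_xx i j : cl (xt i) * cl (xt j) = la i j *: (cl (xt j) * cl (xt i)).
Proof.
have /clsP := eqv_rel (wr_xx K pm i j).
rewrite /sbr !clsE scale0r sgn_epsE scaleNr => /eqP; rewrite subr_eq0 => /eqP //.
Qed.

Lemma weyl_dd i j : cl (dt i) * cl (dt j) = la i j *: (cl (dt j) * cl (dt i)).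
Proof.
have /clsP := eqv_rel (wr_dd K pm i j).
rewrite /sbr !clsE scale0r sgn_epsE scaleNr => /eqP; rewrite subr_eq0 => /eqP //.
Qed.

Lemma weyl_dx i j : cl (dt i) * cl (xt j) =
  ((i == j) : nat)%:R *: (1 : weyl) + la i j *: (cl (xt j) * cl (dt i)).
Proof.
have /clsP := eqv_rel (wr_dx K pm i j).
by rewrite /sbr !clsE sgn_epsE scaleNr => <-; rewrite subrK.
Qed.

Lemma cls_xword l : cl (xword l) = \prod_(i <- l) cl (xt i).
Proof. by elim: l => [|i l ih]; rewrite ?big_nil ?big_cons //= clsM ih. Qed.

Lemma cls_dword l : cl (dword l) = \prod_(i <- l) cl (dt i).
Proof. by elim: l => [|i l ih]; rewrite ?big_nil ?big_cons //= clsM ih. Qed.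

Local Notation wm := (fun k => cl (wmono k)).

Lemma spanned_wmono l m : spanned predT wm (cl (xword l) * cl (dword m)).
Proof.
rewrite -[_ * _](clsM (weyl_rel pm) (xword l) (dword m)).
exact: (@spanned_mono _ _ _ predT wm (l, m)).
Qed.

Lemma spanned_mulx i w : spanned predT wm w -> spanned predT wm (cl (xt i) * w).
Proof.
apply: spanned_map; [exact: mulrDr|by move=> c v; rewrite -qscaleAr|].
move=> [l m] _; rewrite clsM mulrA.
by have := spanned_wmono (i :: l) m; rewrite /= clsM.
Qed.

Lemma spanned_muld i w : spanned predT wm w -> spanned predT wm (cl (dt i) * w).
Proof.
apply: spanned_map; [exact: mulrDr|by move=> c v; rewrite -qscaleAr|].
move=> [l m] _; rewrite clsM; elim: l => [|j l ih].
  by have := spanned_wmono [::] (i :: m); rewrite /= !cls1 !mul1r clsM.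
rewrite /= clsM !mulrA weyl_dx !mulrDl -!qscaleAl mul1r.
apply: spannedD; apply: spannedZ; first exact: spanned_wmono.
by rewrite -!mulrA; apply: spanned_mulx.
Qed.

Lemma spanned_mul t w : spanned predT wm w -> spanned predT wm (cl t * w).
Proof.
elim: t w => [[i|i]|c|s ihs t iht|s ihs t iht] w sw.
- exact: spanned_mulx.
- exact: spanned_muld.
- by rewrite clsC -qscaleAl mul1r; apply: spannedZ.
- by rewrite clsD mulrDl; apply: spannedD; [apply: ihs|apply: iht].
- by rewrite clsM -mulrA; apply: ihs; apply: iht.
Qed.

Lemma weyl_spanned t : spanned normal_key wm (cl t).
Proof.
have /(spanned_mul t) : spanned predT wm 1.
  have -> : 1 = cl (wmono ([::], [::])) by rewrite clsM /= !cls1 mulr1.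
  exact: (@spanned_mono _ _ _ predT wm ([::], [::])).
rewrite mulr1; apply: (spanned_map (f := id)) => //= -[l m] _.
rewrite clsM cls_xword cls_dword.
have [c [l' [nl ->]]] := prod_normal weyl_xx l.
have [d [m' [nm ->]]] := prod_normal weyl_dd m.
rewrite -qscaleAr -qscaleAl; do 2!apply: spannedZ.
rewrite -cls_xword -cls_dword -[_ * _](clsM (weyl_rel pm) (xword l') (dword m')).
by apply: (@spanned_mono _ _ _ normal_key wm (l', m')); rewrite /normal_key nl.
Qed.

(** The coefficients of the action on weight vectors are the pairings of a normal form of [t], so
    triangularity in the number of derivations makes the normal form vanish. *)
Lemma act_faithful t : (forall a, fock a -> forall b, act t (delta a) b = 0) ->
  weyl_eq pm t (tC 0).
Proof.
move=> t0; apply/clsP; rewrite cls0; have [L nL tL] := weyl_spanned t.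
rewrite tL.
apply: (@triangular_sum0 _ _ _ normal_key wm (fun k => size k.2) pairing) => //.
- exact: pairing_diag.
- exact: pairing_triangular.
move=> k /andP[_ /andP[_ fk]]; rewrite -[RHS](t0 _ fk (cnt k.1)).
have /clsP/act_sound -> : cl t = cl (tsum [seq tMul (tC x.1) (wmono x.2) | x <- L]).
  by rewrite tL clsE big_map; apply: eq_bigr => x _; rewrite clsM clsC -qscaleAl mul1r.
  by elim: L {nL tL} => [|x L ih] /=; rewrite ?(big_nil, mul0r, big_cons) // ih.
exact: delta_supp.
Qed.

(** * The ring R *)

Local Notation Rquo := (quo (@Rpm_rel K p q pm)).
Local Notation clR := (@cls K I (Rpm_rel pm)).

(** Polynomials in the [u_i] are evaluated at the joint eigenvalues of the operators [d_i x_i] on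
    weight [b]. *)
Fixpoint reval (r : term K I) (b : deg) : K :=
  match r with
  | tVar i => uval i b
  | tC c => c
  | tAdd r s => reval r b + reval s b
  | tMul r s => reval r b * reval s b
  end.

Lemma uvalN1 i b : fock b -> la i i = -1 -> uval i b * uval i b = uval i b.
Proof.
move=> /fockP/(_ i)[b0 b1] li; rewrite /uval li.
have [->|->] : b i = 0 \/ b i = 1 by have := b1 li; lia.
  by rewrite mulr0 addr0 mulr1.
by rewrite mulr1 subrr mulr0.
Qed.

Lemma reval_sound r s b : fock b -> R_eq (Rpm_rel pm) r s -> reval r b = reval s b.
Proof.
move=> fb; elim=> {r s} /=; try by move=> *; (congruence || ring).
by move=> r s [i j|i li] /=; [ring|exact: uvalN1].
Qed.

Definition uroot (i : I) (k : nat) : K := 1 + la i i * k%:R.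

(* Newton basis: the factors of [u_i] are based at its successive eigenvalues. *)
Fixpoint nword (l : seq I) : term K I :=
  if l is i :: l then tMul (tSub (ut K i) (tC (uroot i (count_mem i l)))) (nword l)
  else tC 1.

(** The factors at index [i] vanish exactly at the coordinates 0, 1, ..., [count_mem i l' - 1]. *)
Lemma reval_nword l l' :
  (reval (nword l') (cnt l) != 0) = [forall i, (count_mem i l' <= count_mem i l)%N].
Proof.
elim: l' => [|i l' ih] /=.
  by rewrite oner_eq0; apply/esym/forallP.
rewrite mulf_eq0 negb_or ih mulN1r /uval /uroot opprD addrACA subrr add0r -mulrBr.
rewrite mulf_eq0 (negPf (lam_neq0 _ _)) /= cntE -pmulrn subr_eq0 eq_natK.
apply/andP/forallP => [[ne /forallP h] j|h].
  have := h j; case: eqP => [ij|//]; subst j.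
  by rewrite add1n ltn_neqAle => ->; rewrite eq_sym ne.
split; last by apply/forallP => j; apply: leq_trans (h j); rewrite leq_addl.
by have := h i; rewrite eqxx add1n eq_sym => /ltn_eqF ->.
Qed.

Local Notation ph := (fun l => clR (nword l)).
Local Notation fac := (fun i k => clR (ut K i) - uroot i k *: (1 : Rquo)).

Lemma facC i j k k' : fac i k * fac j k' = fac j k' * fac i k.
Proof.
have uC : clR (ut K i) * clR (ut K j) = clR (ut K j) * clR (ut K i).
  have /clsP := eqv_rel (Rr_comm K pm i j); by rewrite !clsM.
have commZ c (x : Rquo) : GRing.comm x (c *: (1 : Rquo)).
  by rewrite /GRing.comm -qscaleAl -qscaleAr mul1r mulr1.
apply: commrB; last exact: commZ.
by apply/commr_sym/commrB; [exact/esym|exact: commZ].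
Qed.

Lemma ph_cons i l : ph (i :: l) = fac i (count_mem i l) * ph l.
Proof. by rewrite /= clsM clsB clsC. Qed.

Lemma ph_rem i l : i \in l -> ph l = ph (i :: rem i l).
Proof.
elim: l => // j l ih; rewrite inE [rem _ _]/=; have [-> //|nij] := eqVneq j i.
rewrite /= => il; rewrite -/nword; have il' := perm_to_rem il.
rewrite [LHS]ph_cons (ih il) !ph_cons mulrA facC -mulrA.
by rewrite (permP il') /= [i == j]eq_sym (negPf nij) !(clsM, clsB, clsC).
Qed.

Lemma ph_perm l l' : perm_eq l l' -> ph l = ph l'.
Proof.
elim: l' l => [|i l' ih] l ll'; first by rewrite (perm_nilP ll').
have il : i \in l by rewrite (perm_mem ll') mem_head.
have pl : perm_eq (rem i l) l'.
  by rewrite -(perm_cons i) -(permPl (perm_to_rem il)).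
by rewrite (ph_rem il) !ph_cons (ih _ pl) (permP pl).
Qed.

Lemma ph_eq0 i l : la i i = -1 -> (1 < count_mem i l)%N -> ph l = 0.
Proof.
move=> li; elim: l => // j l ih; rewrite ph_cons /=.
have [lt|] := ltnP 1 (count_mem i l); first by rewrite ih ?mulr0.
case: eqP => [->|_ le]; last by rewrite add0n ltnNge le.
rewrite add1n ltnS leq_eqVlt => + c1; rewrite ltnNge c1 orbF => /eqP c1'.
have il : i \in l by rewrite -has_pred1 has_count c1'.
have c0 : count_mem i (rem i l) = 0%N.
  by move: c1'; rewrite (permP (perm_to_rem il)) /= eqxx add1n => -[].
rewrite c1' (ph_rem il) ph_cons c0 mulrA.
(* At a Clifford index the first two roots are 1 and 0, so the two factors multiply to
   [u_i (u_i - 1) = 0]. *)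
rewrite /uroot li mulr0 mulr1 addr0 subrr scale0r subr0 scale1r.
have /clsP := eqv_rel (Rr_idem li); rewrite clsM mulrBr mulr1 => ->.
by rewrite subrr mul0r.
Qed.

Lemma spanned_mulR r w : spanned predT ph w -> spanned predT ph (clR r * w).
Proof.
elim: r w => [i|c|s ihs t iht|s ihs t iht] w sw.
- move: w sw; apply: spanned_map; [exact: mulrDr|by move=> c v; rewrite -qscaleAr|].
  (* Split [u_i] as its next Newton factor plus a root: the first term lengthens the word, the
     second rescales it. *)
  move=> l _; rewrite -[_ * _](subrK (uroot i (count_mem i l) *: ph l)).
  apply: spannedD; last by apply: spannedZ; exact: (@spanned_mono _ _ _ predT ph l).
  rewrite -[X in _ - _ *: X]mul1r qscaleAl -mulrBl -ph_cons.
  exact: (@spanned_mono _ _ _ predT ph (i :: l)).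
- by rewrite clsC -qscaleAl mul1r; apply: spannedZ.
- by rewrite clsD mulrDl; apply: spannedD; [apply: ihs|apply: iht].
- by rewrite clsM -mulrA; apply: ihs; apply: iht.
Qed.

Lemma R_spanned r : spanned normal_word ph (clR r).
Proof.
have /(spanned_mulR r) : spanned predT ph 1.
  by rewrite -[1](cls1 (Rpm_rel pm)); exact: (@spanned_mono _ _ _ predT ph [::]).
rewrite mulr1; apply: (spanned_map (f := id)) => //= l _.
have [fl|nfl] := boolP (fock (cnt l)).
  pose l' := sort (fun i j : I => (i <= j)%N) l.
  have ll' : perm_eq l l' by rewrite perm_sym perm_sort.
  rewrite (ph_perm ll'); apply: (@spanned_mono _ _ _ normal_word ph).
  rewrite /normal_word -(perm_cnt ll') fl andbT.
  by apply: sort_sorted => i j; exact: leq_total.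
have [i li ci] := not_fock_cnt nfl; rewrite (ph_eq0 li ci); exact: spanned0.
Qed.

(** Evaluation at weights is triangular on Newton words with respect to length: a word not vanishing
    at [cnt l] is contained in [l]. *)
Lemma reval_faithful r s : (forall b, fock b -> reval r b = reval s b) ->
  R_eq (Rpm_rel pm) r s.
Proof.
move=> rs; apply/clsP/eqP; rewrite -subr_eq0 -clsB; apply/eqP.
have [L nL tL] := R_spanned (tSub r s); rewrite tL.
apply: (@triangular_sum0 _ _ _ normal_word ph size
          (fun l' l => reval (nword l') (cnt l))) => //.
- by move=> l _; rewrite reval_nword; apply/forallP.
- move=> l l' /andP[sl _] /andP[sl' _] sz; apply: contraNeq.
  rewrite reval_nword => /forallP h; apply/eqP/sorted_word_eq => //.
  by rewrite perm_sym; apply: cnt_le_perm.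
move=> l /andP[_ fl].
have r0 : reval (tSub r s) (cnt l) = 0 by rewrite /= rs // mulN1r subrr.
rewrite -[RHS]r0.
have /clsP/(reval_sound fl) -> :
    clR (tSub r s) = clR (tsum [seq tMul (tC x.1) (nword x.2) | x <- L]).
  by rewrite tL cls_sum big_map; apply: eq_bigr => x _; rewrite clsM clsC -qscaleAl mul1r.
by elim: L {nL tL} => [|x L ih] /=; rewrite ?(big_nil, big_cons) // ih.
Qed.

(** * The TGW construction *)

(** Identities in the superalgebra can from here on be verified as identities of operators. *)
Lemma weyl_eq_act s t : (forall f, supported f -> act s f = act t f) ->
  weyl_eq pm s t.
Proof.
move=> st; have /act_faithful/clsP : forall a, fock a -> forall b,
    act (tSub s t) (delta a) b = 0.
  by move=> a fa b; rewrite /= st ?mulN1r ?subrr //; exact: delta_supp.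
by rewrite clsB cls0 => /eqP; rewrite subr_eq0 => /eqP/clsP.
Qed.

Local Notation CT := (term K (tgwGen n I)).
Local Notation Rrel := (@Rpm_rel K p q pm).
Local Notation ta := (@tau K p q pm).
Local Notation uu := (@ut K p q).
Local Notation tgwrel := (tgw_rel Rrel ta uu la).
Local Notation Ceq := (tgwC_eq Rrel ta uu la).
Local Notation io := (@tgw_iota K n I).
Local Notation tsig := (tgw_sig ta).

Definition chi_gen (g : tgwGen n I) : term K (wGen p q) :=
  match g with
  | gR i => tMul (dt i) (xt i)
  | gX i => xt i
  | gY i => dt i
  end.

Definition chi (a : CT) : term K (wGen p q) := tsubst chi_gen a.

Lemma act_iota r f : supported f -> act (chi (io r)) f = fun b => reval r b * f b.
Proof.
elim: r f => [i|c|r ihr s ihs|r ihr s ihs] f sf //=.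
- by apply/funext => b; rewrite opdx.
- by apply/funext => b; rewrite ihr ?ihs // mulrDl.
- apply/funext => b; rewrite ihs // ihr ?mulrA // => b' nb.
  by rewrite sf ?mulr0.
Qed.

(** On weights [tau i] is the shift by [- e i]. At a Clifford index both weights are Fock only when
    [b i = 1], and there the reflection of [u_i] to [1 - u_i] agrees with the shift. *)
Lemma reval_tau i r b : fock b -> fock (b - e i) ->
  reval (tsig i r) b = reval r (b - e i).
Proof.
move=> /fockP/(_ i)[_ b1] /fockP/(_ i)[+ _]; rewrite coordB eqxx => b0.
rewrite /tgw_sig; elim: r => [j|c|r ihr s ihs|r ihr s ihs] //=; rewrite ?ihr ?ihs //.
rewrite /tau; case: eqP => [->|/eqP nij]; last first.
  by rewrite /= /uval coordB eq_sym (negPf nij) subr0.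
rewrite /= /uval coordB eqxx intrB; case: (lam_pm1 i i) => li; rewrite li; first by ring.
have -> : b i = 1 by have := b1 li; lia.
by ring.
Qed.

Lemma tgw_rel_act s t : tgwrel s t ->
  forall f, supported f -> act (chi s) f = act (chi t) f.
Proof.
move=> st f sf; apply/funext => b; case: st => {s t} [r s rs|i r|i r|i|i|i j nij].
- rewrite !act_iota //; have [fb|nb] := boolP (fock b); last by rewrite sf ?mulr0.
  by rewrite (reval_sound fb (eqv_rel rs)).
- rewrite /= !act_iota //; last exact: opx_supp.
  rewrite /opx; case: ifP => fb; last by rewrite mulr0.
  have [fbi|nb] := boolP (fock (b - e i)); last by rewrite sf ?mulr0.
  by rewrite reval_tau //; ring.
- rewrite /= !act_iota //; last exact: opd_supp.
  rewrite /opd; case: ifP => fb; last by rewrite mulr0.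
  have [fbi|nb] := boolP (fock (b + e i)); last by rewrite sf ?mulr0.
  by rewrite reval_tau ?addrK //; ring.
- by [].
- rewrite /= act_iota // opxd // /tgw_sig /= /tau eqxx /= /uval.
  by rewrite addrAC mulN1r subrr add0r mulrA lam_sqr mul1r.
- rewrite /= opdxC 1?eq_sym // mulrA [la j i]lamC lam_sqr mul1r.
  by [].
Qed.

Lemma chi_sound s t : Ceq s t -> weyl_eq pm (chi s) (chi t).
Proof.
by apply: eqv_tsubst => a b ab; apply: weyl_eq_act; exact: tgw_rel_act.
Qed.

(** Each generator shifts weights by its degree, and shifts add up under products; this is how the
    grading is seen on states. *)
Lemma homog_local d a : homog d a -> forall f g b, f (b - d) = g (b - d) ->
  act (chi a) f b = act (chi a) g b.
Proof.
elim=> {d a} [c|j|i|i|d s t _ ihs _ iht|d d' s t _ ihs _ iht] f g b /=.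
- by rewrite subr0 => ->.
- by rewrite subr0 /opd /opx addrK => ->.
- by rewrite /opx => ->.
- by rewrite opprK /opd => ->.
- by move=> fg; rewrite (ihs _ _ _ fg) (iht _ _ _ fg).
- by move=> fg; apply: ihs; apply: iht; rewrite -addrA -opprD.
Qed.

(** * Reduced monomials and the degree zero component of the TGW construction *)

Local Notation Cquo := (quo tgwrel).
Local Notation clC := (@cls K (tgwGen n I) tgwrel).
Local Notation TX := (fun i => clC (Xt K I i)).
Local Notation TY := (fun i => clC (Yt K I i)).

Lemma iota_sound r s : R_eq (Rpm_rel pm) r s -> clC (io r) = clC (io s).
Proof.
move=> rs; apply/clsP; apply: eqv_tsubst rs => a b ab.
by apply: eqv_rel; exact: tgwr_R.
Qed.

(** The witness substitutes the inverse automorphism, [u_i] to [la i i * u_i + 1]. It serves to move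
    [Y_i] past any element of R, as its relation is stated only for images of [tau i]. *)
Lemma tau_surj i r : exists r', R_eq (Rpm_rel pm) (tsig i r') r.
Proof.
exists (tsubst (fun j => if j == i then tAdd (tScale (la i i) (ut K i)) (tC 1)
                         else ut K j) r).
rewrite /tgw_sig; elim: r => [j|c|r ihr s ihs|r ihr s ihs] /=;
  [|exact: eqv_refl|exact: eqv_add|exact: eqv_mul].
apply: reval_faithful => b _.
case: eqP => [->|/eqP /negPf nij] /=; last by rewrite /tau nij /=.
by rewrite /tau eqxx /= mulrA lam_sqr mul1r mulN1r subrK.
Qed.

Lemma X_iota i r : TX i * clC (io r) = clC (io (tsig i r)) * TX i.
Proof. by have /clsP := eqv_rel (tgwr_X Rrel ta uu la i r); rewrite !clsM. Qed.

Lemma Y_iota i r : exists r', TY i * clC (io r) = clC (io r') * TY i.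
Proof.
have [r' rr'] := tau_surj i r; exists r'; rewrite -(iota_sound rr').
by have /clsP := eqv_rel (tgwr_Y Rrel ta uu la i r'); rewrite !clsM.
Qed.

Lemma XY_iota i : TX i * TY i = clC (io (tsig i (ut K i))).
Proof. by have /clsP := eqv_rel (tgwr_XY Rrel ta uu la i); rewrite !clsM. Qed.

Lemma YX_iota i : TY i * TX i = clC (io (ut K i)).
Proof. by have /clsP := eqv_rel (tgwr_YX Rrel ta uu la i); rewrite !clsM. Qed.

Lemma XY_swap i j : i != j -> TX i * TY j = la i j *: (TY j * TX i).
Proof.
by move=> ij; have /clsP := eqv_rel (tgwr_mu Rrel ta uu la ij); rewrite clsZ !clsM.
Qed.

Lemma YX_swap i j : i != j -> TY i * TX j = la j i *: (TX j * TY i).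
Proof. by move=> ij; rewrite XY_swap 1?eq_sym // scalerA lam_sqr scale1r. Qed.

Lemma words_swap (y z : I -> Cquo) (c : I -> I -> K) l l' :
  (forall i j, i != j -> y i * z j = c i j *: (z j * y i)) ->
  ~~ has (mem l) l' ->
  exists d : K, \prod_(i <- l) y i * \prod_(j <- l') z j =
    d *: (\prod_(j <- l') z j * \prod_(i <- l) y i).
Proof.
move=> yz; rewrite has_sym.
have one i : i \notin l' ->
    exists d : K, y i * \prod_(j <- l') z j = d *: (\prod_(j <- l') z j * y i).
  elim: l' => [_|j l' ih].
    by exists 1; rewrite big_nil mulr1 mul1r scale1r.
  rewrite inE negb_or => /andP[ij /ih[d hd]]; exists (c i j * d).
  by rewrite big_cons mulrA yz // -qscaleAl -mulrA hd -qscaleAr scalerA mulrA.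
elim: l => [_|i l ih /=].
  by exists 1; rewrite big_nil mulr1 mul1r scale1r.
rewrite negb_or => /andP[/one[d hd] /ih[d' hd']]; exists (d' * d).
by rewrite big_cons -mulrA hd' -qscaleAr mulrA hd -qscaleAl scalerA -mulrA.
Qed.

(** The letter [y i] moves right up to scalars until it meets the first [z i]; their product lies in
    R and travels back to the left end. *)
Lemma absorb (y z : I -> Cquo) (c : I -> I -> K) i l :
  (forall i j, i != j -> y i * z j = c i j *: (z j * y i)) ->
  (forall i, exists r, y i * z i = clC (io r)) ->
  (forall i r, exists r', z i * clC (io r) = clC (io r') * z i) ->
  i \in l -> exists d r,
    y i * \prod_(j <- l) z j = d *: (clC (io r) * \prod_(j <- rem i l) z j).
Proof.
move=> yz yzi zr; elim: l => // j l ih; rewrite inE /= big_cons.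
have [-> _|nij /=] := eqVneq j i.
  by have [r hr] := yzi i; exists 1, r; rewrite mulrA hr scale1r.
move=> /ih[d [r hr]]; have [r' hr'] := zr j r; exists (c i j * d), r'.
by rewrite mulrA yz 1?eq_sym // -qscaleAl -mulrA hr -qscaleAr scalerA
  big_cons mulrA hr' !mulrA.
Qed.

Definition tgw_mono (k : term K I * seq I * seq I) : Cquo :=
  clC (io k.1.1) * (\prod_(i <- k.1.2) TY i * \prod_(i <- k.2) TX i).

(** The [Y] and [X] words share no index, so that in degree 0 both are forced to be empty. *)
Definition reduced (d : deg) : pred (term K I * seq I * seq I) :=
  fun k => ~~ has (mem k.1.2) k.2 && (cnt k.2 - cnt k.1.2 == d).

Lemma clC_iotaM r s : clC (io r) * clC (io s) = clC (io (tMul r s)).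
Proof. exact/esym/clsM. Qed.

Lemma spanned_tgw_mono d r yw xw : ~~ has (mem yw) xw -> cnt xw - cnt yw = d ->
  spanned (reduced d) tgw_mono
    (clC (io r) * (\prod_(i <- yw) TY i * \prod_(i <- xw) TX i)).
Proof.
move=> dis dd; apply: (@spanned_mono _ _ _ (reduced d) tgw_mono (r, yw, xw)).
by rewrite /reduced /= dis dd eqxx.
Qed.

Lemma cnt_rem i l : i \in l -> cnt l = e i + cnt (rem i l).
Proof. by move=> il; rewrite (perm_cnt (perm_to_rem il)) cnt_cons. Qed.

Lemma has_rem (l l' : seq I) i : ~~ has (mem l) l' -> ~~ has (mem l) (rem i l').
Proof. by apply: contra => /hasP[j /mem_rem jl' jl]; apply/hasP; exists j. Qed.

Lemma spanned_X d i w : spanned (reduced d) tgw_mono w ->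
  spanned (reduced (e i + d)) tgw_mono (TX i * w).
Proof.
apply: spanned_map; [exact: mulrDr|by move=> c v; rewrite -qscaleAr|].
move=> [[r yw] xw] /andP[/= dis /eqP <-].
rewrite /tgw_mono /= mulrA X_iota -mulrA [X in _ * X]mulrA.
have [iy|niy] := boolP (i \in yw).
  have [c [s ->]] := absorb XY_swap (fun i => ex_intro _ _ (XY_iota i)) Y_iota iy.
  rewrite -qscaleAl -qscaleAr; apply: spannedZ; rewrite -mulrA mulrA clC_iotaM.
  apply: spanned_tgw_mono; first by rewrite has_sym has_rem // has_sym.
  by rewrite (cnt_rem iy) opprD addrA addrACA subrr add0r.
have [c] : exists c : K, TX i * \prod_(j <- yw) TY j = c *: (\prod_(j <- yw) TY j * TX i).
  have := @words_swap _ _ _ [:: i] yw XY_swap; rewrite !big_seq1; apply.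
  by rewrite has_sym /= orbF.
move=> ->; rewrite -qscaleAl -qscaleAr; apply: spannedZ; rewrite -[X in _ * X]mulrA.
have -> : TX i * \prod_(j <- xw) TX j = \prod_(j <- i :: xw) TX j by rewrite big_cons.
by apply: spanned_tgw_mono; rewrite ?cnt_cons ?addrA //= negb_or niy.
Qed.

Lemma spanned_Y d i w : spanned (reduced d) tgw_mono w ->
  spanned (reduced (- e i + d)) tgw_mono (TY i * w).
Proof.
apply: spanned_map; [exact: mulrDr|by move=> c v; rewrite -qscaleAr|].
move=> [[r yw] xw] /andP[/= dis /eqP <-].
have [r' hr'] := Y_iota i r; rewrite /tgw_mono /= mulrA hr' -mulrA.
have [ix|nix] := boolP (i \in xw); last first.
  rewrite [X in _ * X]mulrA.
  have -> : TY i * \prod_(j <- yw) TY j = \prod_(j <- i :: yw) TY j by rewrite big_cons.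
  apply: spanned_tgw_mono; last by rewrite cnt_cons opprD addrCA.
  by rewrite has_sym /= negb_or nix has_sym.
(* The [X] word is brought in front of the [Y] word so that [Y_i] can be absorbed, and is then moved
   back. *)
have [c ->] := words_swap YX_swap dis.
have [c' [s hs]] := absorb YX_swap (fun i => ex_intro _ _ (YX_iota i))
  (fun i r => ex_intro _ _ (X_iota i r)) ix.
have dis' : ~~ has (mem (rem i xw)) yw by rewrite has_sym has_rem.
have [c'' hc''] := words_swap XY_swap dis'.
rewrite -qscaleAr [TY i * _]mulrA hs -!qscaleAl -mulrA hc'' -!qscaleAr.
do 3!apply: spannedZ; rewrite mulrA clC_iotaM.
apply: spanned_tgw_mono; first exact: has_rem.
by rewrite (cnt_rem ix) -[in RHS]addrA addKr.
Qed.

Lemma spanned_homog d a : homog d a -> forall d' w,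
  spanned (reduced d') tgw_mono w -> spanned (reduced (d + d')) tgw_mono (clC a * w).
Proof.
elim=> {d a} [c|j|i|i|d s t _ ihs _ iht|d d2 s t _ ihs _ iht] d' w sw.
- by rewrite add0r clsC -qscaleAl mul1r; exact: spannedZ.
- rewrite add0r; move: w sw; apply: spanned_map;
    [exact: mulrDr|by move=> c v; rewrite -qscaleAr|].
  move=> [[r yw] xw] /andP[/= dis /eqP dd]; rewrite /tgw_mono /= mulrA.
  by rewrite -[cls _ _]/(clC (io (ut K j))) clC_iotaM; apply: spanned_tgw_mono.
- exact: spanned_X.
- exact: spanned_Y.
- by rewrite clsD mulrDl; apply: spannedD; [apply: ihs|apply: iht].
- by rewrite clsM -mulrA -addrA; apply: ihs; apply: iht.
Qed.

(** In a reduced monomial of degree 0 the two words have the same letters and no common letter, so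
    only the factor from R is left. *)
Lemma homog0_iota a : homog 0 a -> exists r, Ceq a (io r).
Proof.
move=> /spanned_homog h.
have : spanned (reduced 0) tgw_mono (clC a).
  rewrite -[clC a]mulr1 -[0]addr0; apply: h.
  have := @spanned_tgw_mono 0 (tC 1) [::] [::]; rewrite !big_nil !mulr1; apply=> //.
  by rewrite subrr.
case=> L PL aL; suff [r hr] : exists r, clC a = clC (io r) by exists r; apply/clsP.
rewrite aL; elim: L PL {aL} => [_|[c [[r yw] xw]] L ih].
  by exists (tC 0); rewrite big_nil cls0.
move=> /andP[/andP[/= dis /eqP dd] /ih[s hs]]; rewrite big_cons hs /=.
exists (tAdd (tMul (tC c) r) s); rewrite /tgw_mono /= clsD clsM clsC -qscaleAl mul1r.
have cxy : cnt xw = cnt yw by apply/eqP; rewrite -subr_eq0 dd.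
have pxy := cnt_eq_perm cxy; move: dis pxy; case: xw {dd cxy} => [|i xw].
  by move=> _; rewrite perm_sym => /perm_nilP ->; rewrite !big_nil !mulr1.
by move=> /= + pxy; rewrite -(perm_mem pxy) mem_head.
Qed.

(** * The maximal graded ideal *)

Definition chi_kernel (a : CT) : Prop := weyl_eq pm (chi a) (tC 0).

Lemma chi_kernelP a : chi_kernel a <-> cl (chi a) = 0.
Proof. by rewrite -cls0; split=> /clsP. Qed.

Lemma cls_chi_eq a b : Ceq a b -> cl (chi a) = cl (chi b).
Proof. by move=> /chi_sound/clsP. Qed.

Lemma chi_kernel_act a f : chi_kernel a -> supported f -> act (chi a) f = fun=> 0.
Proof.
move=> ka sf; rewrite (act_sound ka sf) /=; apply/funext => b.
by rewrite mul0r.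
Qed.

Lemma chi_kernel_ideal : is_ideal Rrel ta uu la chi_kernel.
Proof.
split.
- by move=> a b /cls_chi_eq ab /chi_kernelP ka; apply/chi_kernelP; rewrite -ab.
- exact: eqv_refl.
- move=> a b /chi_kernelP ka /chi_kernelP kb; apply/chi_kernelP.
  by rewrite [chi _]/= clsD ka kb addr0.
- move=> a b /chi_kernelP kb; split; apply/chi_kernelP; rewrite [chi _]/= clsM kb.
    by rewrite mulr0.
  by rewrite mul0r.
Qed.

Lemma homog_decomposition a : exists2 l : seq (deg * CT),
  clC a = \sum_(x <- l) clC x.2 & forall x, x \in l -> homog x.1 x.2.
Proof.
have single d t : homog d t -> exists2 l : seq (deg * CT),
    clC t = \sum_(x <- l) clC x.2 & forall x, x \in l -> homog x.1 x.2.
  move=> h; exists [:: (d, t)]; first by rewrite big_seq1.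
  by move=> x; rewrite inE => /eqP ->.
elim: a => [[i|i|i]|c|s [l sl hl] t [l' tl' hl']|s [l sl hl] t [l' tl' hl']].
- by apply: single; exact: homog_R.
- by apply: single; exact: homog_X.
- by apply: single; exact: homog_Y.
- by apply: single; exact: homog_C.
- exists (l ++ l'); first by rewrite clsD sl tl' big_cat.
  by move=> x; rewrite mem_cat => /orP[/hl|/hl'].
exists [seq (x.1 + y.1, tMul x.2 y.2) | x <- l, y <- l'].
  rewrite clsM sl tl' big_allpairs_dep mulr_suml; apply: eq_bigr => x _.
  by rewrite mulr_sumr; apply: eq_bigr => y _; rewrite clsM.
move=> x /allpairsP[[y z] [/= /hl hy /hl' hz ->]].
exact: homog_mul.
Qed.

Definition component (l : seq (deg * CT)) (d : deg) : CT :=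
  tsum [seq x.2 | x <- l & x.1 == d].

Lemma cls_component l d : clC (component l d) = \sum_(x <- l | x.1 == d) clC x.2.
Proof. by rewrite cls_sum big_map big_filter. Qed.

Lemma component_in_deg l d : (forall x, x \in l -> homog x.1 x.2) ->
  d \in map fst l -> in_deg Rrel ta uu la d (component l d).
Proof.
move=> hl /mapP[y /hl hy dy].
(* The empty sum [tC 0] is syntactically homogeneous of degree 0 only, so it is replaced by 0 times
   a term of degree [d]. *)
exists (foldr tAdd (tMul (tC 0) y.2) [seq x.2 | x <- l & x.1 == d]).
have h0 : homog d (tMul (tC 0) y.2).
  by rewrite -[d]add0r dy; apply: homog_mul => //; exact: homog_C.
rewrite /component; split.
  elim: [seq _ | _ <- _ & _] => [|x s ih] /=;
    last by apply: eqv_add => //; exact: eqv_refl.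
  by apply/clsP; rewrite clsM cls0 mul0r.
have {}hl x : x \in [seq x <- l | x.1 == d] -> homog d x.2.
  by rewrite mem_filter => /andP[/eqP <- /hl].
elim: [seq _ <- _ | _] hl => //= x s ih hs; apply: homog_add.
  by apply: hs; rewrite mem_head.
by apply: ih => z zs; apply: hs; rewrite inE zs orbT.
Qed.

Lemma act_chi_sum (l : seq CT) f b :
  act (chi (tsum l)) f b = \sum_(x <- l) act (chi x) f b.
Proof. by elim: l => [|x l ih]; rewrite ?(big_nil, big_cons) /= ?mul0r // ih. Qed.

Lemma component_local l d f g b : (forall x, x \in l -> homog x.1 x.2) ->
  f (b - d) = g (b - d) ->
  act (chi (component l d)) f b = act (chi (component l d)) g b.
Proof.
move=> hl fg; rewrite !act_chi_sum !big_map !big_filter big_seq_cond [RHS]big_seq_cond.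
apply: eq_bigr => x /andP[/hl hx /eqP xd].
by apply: (homog_local hx); rewrite xd.
Qed.

Lemma In_mem (T : eqType) (x : T) s : List.In x s -> x \in s.
Proof.
by elim: s => //= y s ih [->|/ih xs]; rewrite inE ?eqxx // xs orbT.
Qed.

(* Testing the kernel on the restriction of a state to a single weight isolates
   one homogeneous component. *)
Lemma chi_kernel_graded : is_graded Rrel ta uu la chi_kernel.
Proof.
move=> a ka; have [l al hl] := homog_decomposition a.
pose U := undup (map fst l).
have aU : Ceq a (tsum (map snd [seq (d, component l d) | d <- U])).
  apply/clsP; rewrite al cls_sum !big_map (sum_by_key fst).
  by apply: eq_bigr => d _; rewrite cls_component.
exists [seq (d, component l d) | d <- U]; split=> // x /In_mem/mapP[d dU ->] /=.
split; first by apply: component_in_deg => //; rewrite -mem_undup.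
apply: weyl_eq_act => f sf /=; apply/funext => b; rewrite mul0r.
pose f' := fun b' => if b' == b - d then f b' else 0.
have sf' : supported f' by move=> b' nb; rewrite /f'; case: ifP => // _; rewrite sf.
have := congr1 (fun h => h b) (chi_kernel_act ka sf'); rewrite /=.
rewrite (act_sound (chi_sound aU) sf') act_chi_sum !big_map (bigD1_seq d) ?undup_uniq //=.
rewrite big1 ?addr0 => [<-|d' nd].
  by apply: component_local => //; rewrite /f' eqxx.
(* A component of another degree [d'] reads the restricted state at [b - d'], where it is 0. *)
rewrite (@component_local _ _ _ (fun=> 0)) ?act0 // /f' (inj_eq (addrI _)) eqr_opp.
by rewrite (negPf nd).
Qed.

(** A degree zero element comes from some [r] in R, which acts on each weight vector by the scalar
    [reval r b]; if all these vanish, so does [r]. *)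
Lemma chi_kernel_deg0 : meets_deg0_trivially Rrel ta uu la chi_kernel.
Proof.
move=> a ka [a' [aa' /homog0_iota[r ar]]]; have air := eqv_trans aa' ar.
apply: (eqv_trans air); apply/clsP.
rewrite -[tC 0 in RHS]/(io (tC 0)); apply: iota_sound; apply: reval_faithful => b fb.
have := chi_kernel_act ka (delta_supp fb).
rewrite (act_sound (chi_sound air) (delta_supp fb)).
rewrite (act_iota _ (delta_supp fb)) => /(congr1 (fun h => h b)) /=.
by rewrite /delta eqxx mulr1.
Qed.

(** * Graded ideals meeting degree zero trivially lie in the kernel of [chi] *)

Lemma word_of_weight b : fock b -> exists l, cnt l = b.
Proof.
move=> fb; exists (\big[cat/[::]]_(i : I) nseq `|b i|%N i).
apply/ffunP => j; rewrite cntE.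
rewrite (big_morph (count_mem j) (count_cat _) (erefl : count_mem j [::] = 0%N)).
rewrite (bigD1 j) //= count_nseq /= eqxx mul1n big1 ?addn0 => [|i ij].
  by case: (fockP _ fb j) => b0 _; rewrite gez0_abs.
by rewrite count_nseq /= (negPf ij).
Qed.

Definition Xword (l : seq I) : CT := foldr (fun i t => tMul (Xt K I i) t) (tC 1) l.
Definition Yword (l : seq I) : CT := foldr (fun i t => tMul (Yt K I i) t) (tC 1) l.

Lemma chi_Xword l : chi (Xword l) = xword l.
Proof. by elim: l => //= i l <-. Qed.

Lemma chi_Yword l : chi (Yword l) = dword l.
Proof. by elim: l => //= i l <-. Qed.

Lemma homog_Xword l : homog (cnt l) (Xword l).
Proof.
elim: l => [|i l ih]; first by rewrite cnt_nil; exact: homog_C.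
by rewrite cnt_cons; apply: homog_mul => //; exact: homog_X.
Qed.

Lemma homog_Yword l : homog (- cnt l) (Yword l).
Proof.
elim: l => [|i l ih]; first by rewrite cnt_nil oppr0; exact: homog_C.
by rewrite cnt_cons opprD; apply: homog_mul => //; exact: homog_Y.
Qed.

(* If [a] moved the weight vector of weight [b - d] to a nonzero vector of weight
   [b], a monomial bringing it back would produce a degree zero element of [J]
   acting nontrivially. *)
Lemma ideal_homog_kernel J d a : is_ideal Rrel ta uu la J ->
  meets_deg0_trivially Rrel ta uu la J -> J a -> in_deg Rrel ta uu la d a ->
  chi_kernel a.
Proof.
move=> [Jeq _ _ JM] J0 Ja [a' [aa' ha']]; have Ja' := Jeq _ _ aa' Ja.
apply/chi_kernelP; rewrite (cls_chi_eq aa'); apply/chi_kernelP.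
apply: weyl_eq_act => f sf; apply/funext => b; rewrite [RHS]/= mul0r.
apply/eqP; apply: contraT => nz.
have fb : fock b := supp_fock (act_supp _ sf) nz.
(* By homogeneity only the coefficient of [f] at [b - d] contributes at [b], so [f] may be replaced
   by a weight vector. *)
have fE : act (chi a') f b = f (b - d) * act (chi a') (delta (b - d)) b.
  have := congr1 (fun h => h b) (actZ (chi a') (f (b - d)) (delta (b - d))) => /= <-.
  by apply: (homog_local ha'); rewrite /delta eqxx mulr1.
move: nz; rewrite fE mulf_eq0 negb_or => /andP[fc gb].
have {}fc := supp_fock sf fc.
set g := act _ _ in gb.
have gE : g = fun b' => g b * delta b b'.
  apply/funext => b'; rewrite /delta; case: eqP => [->|/eqP nb]; first by rewrite mulr1.
  rewrite mulr0 /g (homog_local (g := fun=> 0) ha') ?act0 //.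
  by rewrite /delta (inj_eq (addIr _)) (negPf nb).
have [lb cb] := word_of_weight fb; have [lc cc] := word_of_weight fc.
(* The [Y] word lowers weight [b] to the vacuum, and the [X] word raises the vacuum to weight
   [b - d]. *)
have hm : homog 0 (tMul (tMul (Xword lc) (Yword lb)) a').
  have -> : 0 = cnt lc + - cnt lb + d by rewrite cb cc addrAC subrK subrr.
  by apply: homog_mul => //; apply: homog_mul; [exact: homog_Xword|exact: homog_Yword].
have m0 : Ceq (tMul (tMul (Xword lc) (Yword lb)) a') (tC 0).
  apply: J0; first by case: (JM (tMul (Xword lc) (Yword lb)) a' Ja').
  by eexists; split; [exact: eqv_refl|exact: hm].
have := act_sound (chi_sound m0) (delta_supp fc).
rewrite /= -/g gE -!/(chi _) chi_Xword chi_Yword actZ.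
have := act_dword (l := lb) fock0; rewrite add0r cb => /(_ fb)[c1 c10 ->].
rewrite actZ actZ; move: fc; rewrite -cc => fc; have [c2 c20 ->] := act_xword fc.
move=> /(congr1 (fun h => h (cnt lc))) /eqP; rewrite /delta eqxx mulr1 mul0r.
by rewrite !mulf_eq0 (negPf gb) (negPf c10) (negPf c20).
Qed.

(** The kernel is itself an admissible ideal. Conversely, an element of an admissible ideal is a sum
    of homogeneous elements of that ideal, each of which lies in the kernel. *)
Lemma tgw_maxidealP a : tgw_maxideal Rrel ta uu la a <-> chi_kernel a.
Proof.
split=> [[J [idJ grJ J0 Ja]]|ka]; last first.
  exists chi_kernel; split=> //; [exact: chi_kernel_ideal|exact: chi_kernel_graded|].
  exact: chi_kernel_deg0.
have [l [al hl]] := grJ _ Ja; apply/chi_kernelP; rewrite (cls_chi_eq al).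
elim: l {al} hl => [|x l ih] hl; first exact: cls0.
rewrite [chi _]/= clsD -!/(chi _) ih => [|y yl]; last by apply: hl; right.
have [dx Jx] := hl x (or_introl erefl).
by have /chi_kernelP -> := ideal_homog_kernel idJ J0 Jx dx; rewrite addr0.
Qed.

Lemma tgwA_eqP a b : Rpm_tgwA_eq pm a b <-> weyl_eq pm (chi a) (chi b).
Proof.
split=> [/tgw_maxidealP/chi_kernelP|/clsP h].
  by rewrite [chi _]/= clsB => /eqP; rewrite subr_eq0 => /eqP/clsP.
apply/tgw_maxidealP/chi_kernelP; rewrite [chi _]/= clsB.
by apply/eqP; rewrite subr_eq0; apply/eqP.
Qed.

Lemma chi_surj w : exists a, chi a = w.
Proof.
elim: w => [[i|i]|c|s [a <-] t [b <-]|s [a <-] t [b <-]].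
- by exists (Xt K I i).
- by exists (Yt K I i).
- by exists (tC c).
- by exists (tAdd a b).
- by exists (tMul a b).
Qed.

(** Elements of R equal in the TGW algebra act equally on weight vectors, so their evaluations agree
    at all Fock weights. *)
Lemma Rpm_is_consistent : Rpm_consistent K p q pm.
Proof.
move=> r s /tgwA_eqP rs; apply: reval_faithful => b fb.
have := act_sound rs (delta_supp fb); rewrite !(act_iota _ (delta_supp fb)).
by move=> /(congr1 (fun h => h b)); rewrite /delta eqxx !mulr1.
Qed.

End Representation.

(** * The isomorphism and consistency *)

Theorem mainTheorem3 (K : closedFieldType) (charK0 : [pchar K] =i pred0)
    (p q : nat) (pm : bool) :
  (exists chi : term K (tgwGen (p + q) 'I_(p + q)) -> term K (wGen p q),
      is_alg_iso (Rpm_tgwA_eq pm) (weyl_eq pm) chi /\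
      (forall i : 'I_(p + q),
          [/\ weyl_eq pm (chi (tVar (gX i))) (xt i),
              weyl_eq pm (chi (tVar (gY i))) (dt i) &
              weyl_eq pm (chi (tVar (gR i))) (tMul (dt i) (xt i))]))
  /\ Rpm_consistent K p q pm.
Proof.
split; last exact: Rpm_is_consistent.
exists (@chi K p q); split; last by move=> i; split; exact: eqv_refl.
split.
- by move=> a b /(tgwA_eqP charK0).
- by do 2?split; move=> *; exact: eqv_refl.
- by move=> a b /(tgwA_eqP charK0).
- by move=> w; have [a <-] := chi_surj w; exists a; exact: eqv_refl.
Qed.
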